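(* Let $\mu$ be a probability measure, let $f$ be strictly convex and differentiable on $(0,+\infty)$ with $f(1)=0$ and $\lim_{s\uparrow+\infty}f(s)/s=c$ finite, and let $X$ have $\mu$-essential infimum $m=0$, with the setting and notation of the context. For $\theta_2\le 0$ put $$g(\theta_2):=\int(f^* )'(c+\theta_2X)\,d\mu .$$ If $g(\theta_2)=+\infty$ for each $\theta_2<0$, then a worst case density exists for all $k\in(0,k_{\max})$. Otherwise, denote $$\tilde\theta_{\min}:=\inf\{\theta_2:\ g(\theta_2)\ge1\},\qquad \tilde k_{\mathrm{cr}}:=\tilde\theta_{\min}\,G'_+(\tilde\theta_{\min})-G(\tilde\theta_{\min}),$$ where $G'_+$ is the right derivative. Then $\tilde\theta_{\min}\in(-\infty,0)$, $\tilde k_{\mathrm{cr}}\in(0,k_{\max})$, and for $k\in(0,\tilde k_{\mathrm{cr}})$ a worst case density exists. For $k\in[\tilde k_{\mathrm{cr}},k_{\max})$ the worst case localiser $\hat q_k$ is of the form $\hat q_k=(f^* )'(c+\theta_2X)=p_{c,\theta_2}$ (for some $\theta_2<0$); it is not a density if $k>\tilde k_{\mathrm{cr}}$, while for $k=\tilde k_{\mathrm{cr}}$ it is a density (and hence a worst case density) unless $g(\theta_2)<1$ for each $\theta_2<0$ with $g(\theta_2)<+\infty$.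
   Context: Setting. $\mu$ is a probability measure on a measurable space $\Omega$; equality of functions on $\Omega$ is meant $\mu$-a.e. The function $f$ is extended by $f(0)=\lim_{s\downarrow0}f(s)$ and $f(s)=+\infty$ for $s<0$. Put $H(p):=\int f(p)\,d\mu$ for measurable $p\ge0$. A density is a nonnegative measurable $p$ with $\int p\,d\mu=1$; the default density is $p_0\equiv1$ (default distribution $\mathbb{P}_0=\mu$). $X:\Omega\to\mathbb{R}$ is measurable with $\mu$-essential infimum $m$ and supremum $M$, $b_0:=\int X\,d\mu$ exists, and the standing assumption $m<b_0<M\le+\infty$ holds (here $m=0$). Put $$F(b):=\inf\Big\{H(p):\ p\ge 0,\ \int p\,d\mu=1,\ \int Xp\,d\mu=b\Big\},\qquad k_{\max}:=\lim_{b\downarrow m}F(b),$$ $$V(k):=\inf\Big\{\int Xp\,d\mu:\ p\ge 0,\ \int p\,d\mu=1,\ H(p)\le k\Big\}.$$ The standing assumption $k_{\max}>0$ is in force (it holds automatically in this setting). A worst case density for $k$ is a density $p$ with $H(p)\le k$ and $\int Xp\,d\mu=V(k)$. Conventions: $\inf\emptyset=+\infty$; the integrals defining $H$ and $K$ (below) are $+\infty$ when not well defined. $f^*(\tau):=\sup_{s\in\mathbb{R}}(s\tau-f(s))$ is the convex conjugate, which is finite and differentiable for $\tau<c$ and infinite for $\tau>c$; $(f^* )'(c):=\lim_{\tau\uparrow c}(f^* )'(\tau)=+\infty$. Put $$K(\theta_1,\theta_2):=\int f^*(\theta_1+\theta_2X)\,d\mu,\qquad G(\theta_2):=\inf_{\theta_1\in\mathbb{R}}[K(\theta_1,\theta_2)-\theta_1].$$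 Let $\Theta$ be the set of $(\theta_1,\theta_2)$ with $K(\theta_1,\theta_2)<+\infty$ and $\theta_1+\theta_2X<c$ $\mu$-a.e.; for $(\theta_1,\theta_2)\in\Theta$ put $p_{\theta_1,\theta_2}:=(f^* )'(\theta_1+\theta_2X)$. For $k\in(0,k_{\max})$ the maximum of $\frac{k+K(\theta_1,\theta_2)-\theta_1}{\theta_2}$ over $\theta_1\in\mathbb{R},\ \theta_2<0$ is attained, every maximiser lies in $\Theta$, and the worst case localiser is $\hat q_k:=p_{\theta_1,\theta_2}$ with $(\theta_1,\theta_2)$ a maximiser; as a function it does not depend on the choice of the maximiser. *)

(* Defs.v *)
From HB Require Import structures.
From mathcomp Require Import all_boot all_order all_algebra.
From mathcomp Require Import all_classical all_reals all_analysis ess_sup_inf.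

Set Implicit Arguments.
Unset Strict Implicit.
Unset Printing Implicit Defensive.

Import Order.TTheory GRing.Theory Num.Theory.
Import numFieldNormedType.Exports.

Local Open Scope classical_set_scope.
Local Open Scope ring_scope.
Local Open Scope ereal_scope.

Definition strictly_convex_pos {R : realType} (f : R -> R) : Prop :=
  forall x y t : R, (0 < x)%R -> (0 < y)%R -> x != y -> (0 < t < 1)%R ->
    (f (t * x + (1 - t) * y) < t * f x + (1 - t) * f y)%R.

(* Only the values of [f] on (0, +oo) are used. *)
Definition fext {R : realType} (f : R -> R) (s : R) : \bar R :=
  if (s < 0)%R then +oo
  else if s == 0%R then lim ((f t)%:E @[t --> 0%R^'+])
  else (f s)%:E.

Definition fconj {R : realType} (f : R -> R) (tau : R) : \bar R :=
  ereal_sup [set (s * tau)%:E - fext f s | s in [set: R]].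

(* The derivative of the conjugate, with its left limit at the endpoint [c] of
   the domain; the value beyond [c], where the conjugate is infinite, is only
   ever met on null sets. *)
Definition dfconj {R : realType} (f : R -> R) (c tau : R) : \bar R :=
  let D (t : R) := (derive1 (fun u : R => fine (fconj f u)) t)%:E in
  if (tau < c)%R then D tau else lim (D t @[t --> c^'-]).

(* The integral, with value +oo when it is not well defined
   (the library's convention is +oo - oo = -oo). *)
Definition integral_or_pinfty {d : measure_display} {T : measurableType d}
    {R : realType} (mu : probability T R) (h : T -> \bar R) : \bar R :=
  if (\int[mu]_x h^\+ x == +oo) && (\int[mu]_x h^\- x == +oo) then +oo
  else \int[mu]_x h x.

Section worst_case.
Context {d : measure_display} {T : measurableType d} {R : realType}.
Context (mu : probability T R) (f : R -> R) (X : T -> R).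

Definition Hfun (p : T -> R) : \bar R :=
  integral_or_pinfty mu (fun x => fext f (p x)).

Definition density (p : T -> R) : Prop :=
  [/\ measurable_fun [set: T] p, forall x, (0 <= p x)%R &
      \int[mu]_x (p x)%:E = 1].

Definition Xmean (p : T -> R) : \bar R := \int[mu]_x (X x * p x)%:E.

Definition Ffun (b : R) : \bar R :=
  ereal_inf [set Hfun p | p in [set p | density p /\ Xmean p = b%:E]].

Definition kmax (m : R) : \bar R := lim (Ffun b @[b --> m^'+]).

Definition Vfun (k : R) : \bar R :=
  ereal_inf [set Xmean p | p in [set p | density p /\ Hfun p <= k%:E]].

Definition worst_case_density (k : R) (p : T -> R) : Prop :=
  [/\ density p, Hfun p <= k%:E & Xmean p = Vfun k].

Definition Kfun (th1 th2 : R) : \bar R :=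
  integral_or_pinfty mu (fun x => fconj f (th1 + th2 * X x)).

Definition Gfun (th2 : R) : \bar R :=
  ereal_inf [set Kfun th1 th2 - th1%:E | th1 in [set: R]].

Definition Gright (t : R) : \bar R :=
  lim ((h^-1)%:E * (Gfun (t + h) - Gfun t) @[h --> 0%R^'+]).

Definition Theta (c th1 th2 : R) : Prop :=
  Kfun th1 th2 < +oo /\ {ae mu, forall x, (th1 + th2 * X x < c)%R}.

(* Meaningful for [Theta c th1 th2]; then [fine] is harmless almost
   everywhere. *)
Definition ptheta (c th1 th2 : R) (x : T) : R :=
  fine (dfconj f c (th1 + th2 * X x)).

Definition dual_objective (k th1 th2 : R) : \bar R :=
  (k%:E + Kfun th1 th2 - th1%:E) * (th2^-1)%:E.

Definition dual_maximiser (k th1 th2 : R) : Prop :=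
  (th2 < 0)%R /\
  forall t1 t2 : R, (t2 < 0)%R ->
    dual_objective k t1 t2 <= dual_objective k th1 th2.

(* [q] is, up to a.e. equality, _the_ worst case localiser: the definite
   description includes attainment of the maximum, membership of every
   maximiser in Theta, and independence of the choice of the maximiser. *)
Definition worst_case_localiser (c k : R) (q : T -> R) : Prop :=
  (exists th1 th2 : R, dual_maximiser k th1 th2) /\
  forall th1 th2 : R, dual_maximiser k th1 th2 ->
    Theta c th1 th2 /\ {ae mu, forall x, q x = ptheta c th1 th2 x}.

Definition gfun (c th2 : R) : \bar R := \int[mu]_x dfconj f c (c + th2 * X x).

Definition theta_min (c : R) : \bar R :=
  ereal_inf [set th2%:E | th2 in [set t : R | (t <= 0)%R /\ 1 <= gfun c t]].

(* [fine] is harmless when [theta_min c] is finite. *)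
Definition kcr (c : R) : \bar R :=
  let t := fine (theta_min c) in t%:E * Gright t - Gfun t.

End worst_case.

(* Main.v *)
Require Import Defs.
From HB Require Import structures.
From mathcomp Require Import all_boot all_order all_algebra.
From mathcomp Require Import all_classical all_reals all_analysis ess_sup_inf.
From mathcomp Require Import measurable_realfun.
From mathcomp Require Import ring lra.

Set Implicit Arguments.
Unset Strict Implicit.
Unset Printing Implicit Defensive.

Import Order.TTheory GRing.Theory Num.Theory.
Import numFieldNormedType.Exports.

Local Open Scope classical_set_scope.
Local Open Scope ring_scope.

(** The proof is Lagrangian duality with multipliers th1 (for the mass) and
    th2 < 0 (for the mean).  Write D for the tilted function (f^* )'(th1 + th2 X),
    m for its mass and b for the mean of X D.  Fenchel's inequality gives weak
    duality: if E is the mean of X under a density p with H(p) <= k, then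
    th2 E - k <= G(th2), so E >= (k + G(th2)) / th2 [weak_duality].

    For fixed th2 < 0 the mass of D increases with th1.  Push th1 up until the
    mass is one; if it stays below one, stop at th1 = c.  Such a [normalised]
    point always exists, and since (c - th1) (1 - m) = 0 there and K is +oo for
    th1 > c, it minimises K(th1, th2) - th1 [normalised_Kfun_ge].  The stop at c
    occurs with defect of mass exactly when g(th2) < 1.

    The function G is convex with b as its only subgradient at th2
    [subgradient_unique].  Uniqueness is the main analytic step: to the left one
    moves th2 alone, to the right one must move along (- u, 1) with u > 0, which
    keeps th1 + th2 X away from c where X is large.  Hence, if th2 maximises
    (k + G(th2)) / th2 with value v, then b = v.  If moreover m = 1, the equality
    case of Fenchel's inequality gives H(D) = k, and D is a worst case density
    [full_mass_worst_case].

    A function D with m < 1 can be completed to a density by mass placed where X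
    is small.  As f has slope at most c, this costs at most c (1 - m) in H and
    next to nothing in the mean [completed_density].  Therefore k_max is at most
    the supremum of - G, and maximisers exist for all 0 < k < k_max
    [kmax_dual, attains_exists].  The equality case of the subgradient
    inequality for f^* shows that all maximisers give the same D
    [localiser_unique].

    If g is +oo on the negative half line, normalised points have th1 < c and
    m = 1, and the first claim follows.  Otherwise X > 0 almost everywhere, and g
    is monotone, left continuous, tends to 0 at -oo and is +oo at 0, which places
    theta_min in (-oo, 0).  The radius k for which theta_min is a maximiser is
    theta_min b - G(theta_min), and this is k_cr because the right derivative of
    G is b [GrightE].  Maximisers move strictly to the left as k grows
    [attains_lt]: for k < k_cr they lie to the right of theta_min, where m = 1;
    for k > k_cr they lie to the left, where g < 1, so that D is
    (f^* )'(c + th2 X) and has mass below one. *)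

(** * Integration of real functions over a probability space *)

Section integration.
Context {d : measure_display} {T : measurableType d} {R : realType}.
Context (mu : probability T R).
Implicit Types (u v w : T -> R) (h : T -> \bar R).

Local Notation L1 u := (mu.-integrable [set: T] (EFin \o u)).
Local Notation mean u := (\int[mu]_x u x).

Lemma L1_measurable u : L1 u -> measurable_fun [set: T] u.
Proof. by move=> /measurable_int/measurable_EFinP. Qed.

Lemma L1_cst (a : R) : L1 (fun=> a).
Proof. exact: finite_measure_integrable_cst. Qed.

Lemma mean_cst (a : R) : mean (fun=> a) = a.
Proof. by rewrite Rintegral_cst// [X in fine X]probability_setT/= mulr1. Qed.

Lemma EFin_mean u : L1 u -> (mean u)%:E = (\int[mu]_x (u x)%:E)%E.
Proof. by move=> iu; rewrite fineK//; exact: integrable_fin_num. Qed.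

Lemma L1_Z (a : R) u : L1 u -> L1 (fun x => a * u x).
Proof. by move=> iu; exact: (@integrableZl _ _ _ mu _ _ a (EFin \o u)). Qed.

Lemma L1_comb (a b : R) u v : L1 u -> L1 v -> L1 (fun x => a * u x + b * v x).
Proof.
move=> iu iv.
by apply: (@integrableD _ _ _ mu _ _ (fun x => (a * u x)%:E) (fun x => (b * v x)%:E)) => //;
  exact: L1_Z.
Qed.

Lemma mean_comb (a b : R) u v : L1 u -> L1 v ->
  mean (fun x => a * u x + b * v x) = a * mean u + b * mean v.
Proof.
by move=> iu iv; rewrite RintegralD// ?RintegralZl//; exact: L1_Z.
Qed.

Lemma mean_Z (a : R) u : L1 u -> mean (fun x => a * u x) = a * mean u.
Proof. by move=> iu; rewrite RintegralZl. Qed.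

Lemma L1_B u v : L1 u -> L1 v -> L1 (fun x => u x - v x).
Proof. by move=> iu iv; exact: (@integrableB _ _ _ mu _ _ (EFin \o u) (EFin \o v)). Qed.

Lemma L1_D u v : L1 u -> L1 v -> L1 (fun x => u x + v x).
Proof. by move=> iu iv; exact: (@integrableD _ _ _ mu _ _ (EFin \o u) (EFin \o v)). Qed.

Lemma mean_B u v : L1 u -> L1 v -> mean (fun x => u x - v x) = mean u - mean v.
Proof. by move=> iu iv; rewrite RintegralB. Qed.

Lemma mean_D u v : L1 u -> L1 v -> mean (fun x => u x + v x) = mean u + mean v.
Proof. by move=> iu iv; rewrite RintegralD. Qed.

Lemma L1_norm u : L1 u -> L1 (fun x => `|u x|).
Proof. by move=> /integrable_norm. Qed.

Lemma ae_le_L1 u w : measurable_fun [set: T] u -> L1 w ->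
  {ae mu, forall x, `|u x| <= w x} -> L1 u.
Proof.
move=> mu' iw uw; apply/integrableP; split; first exact/measurable_EFinP.
have /integrableP[mw] := iw; apply: le_lt_trans.
apply: ae_ge0_le_integral => //.
- by apply: measurableT_comp => //; exact/measurable_EFinP.
- exact: measurableT_comp.
apply: filterS uw => x uw _ /=; rewrite lee_fin.
exact: le_trans uw (ler_norm _).
Qed.

(** Integrability of the conjugate and of X times a tilted density is obtained from
    this: convexity supplies integrable bounds on both sides. *)
Lemma ae_sandwich_L1 u v w : measurable_fun [set: T] v -> L1 u -> L1 w ->
  {ae mu, forall x, u x <= v x} -> {ae mu, forall x, v x <= w x} -> L1 v.
Proof.
move=> mv iu iw uv vw.
apply: (@ae_le_L1 v (fun x => `|u x| + `|w x|)) => //.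
  by apply: L1_D; exact: L1_norm.
apply: filterS2 uv vw => x ux xw; rewrite ler_norml.
have := ler_norm (- u x); have := ler_norm (w x); rewrite normrN.
by have := normr_ge0 (u x); have := normr_ge0 (w x); lra.
Qed.

Lemma ae_ge0_mean u : measurable_fun [set: T] u -> {ae mu, forall x, 0 <= u x} -> 0 <= mean u.
Proof.
move=> mu' u0; rewrite /Rintegral; apply: fine_ge0.
rewrite (@ae_eq_integral _ _ _ mu setT (EFin \o (fun x => `|u x|)))//.
- by apply: integral_ge0 => x _; rewrite lee_fin.
- exact/measurable_EFinP.
- by apply/measurable_EFinP; exact: measurableT_comp.
- by apply: filterS u0 => x u0 _ /=; rewrite ger0_norm.
Qed.

Lemma ae_le_mean u v : L1 u -> L1 v -> {ae mu, forall x, u x <= v x} -> mean u <= mean v.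
Proof.
move=> iu iv uv; rewrite -subr_ge0 -mean_B//; apply: ae_ge0_mean.
  by apply/L1_measurable; exact: L1_B.
by apply: filterS uv => x; rewrite subr_ge0.
Qed.

Lemma ae_mean0 u : L1 u -> {ae mu, forall x, 0 <= u x} -> mean u = 0 ->
  {ae mu, forall x, u x = 0}.
Proof.
move=> iu u0 Eu0.
have /(ae_eq_integral_abs mu measurableT (measurable_int _ iu)) : (\int[mu]_x `|(EFin \o u) x| = 0)%E.
  rewrite (@ae_eq_integral _ _ _ mu setT (EFin \o u))//.
  - by rewrite /= -EFin_mean// Eu0.
  - by apply: measurableT_comp => //; exact: measurable_int iu.
  - exact: measurable_int iu.
  - by apply: filterS u0 => x u0 _ /=; rewrite ger0_norm.
by apply: filterS => x /(_ I) /= [].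
Qed.

(** Fatou's lemma in the form in which it bounds a mass at the end of a range of
    multipliers by the masses inside the range. *)
Lemma fatou_le (F : nat -> T -> \bar R) h (C : \bar R) :
  (forall n, measurable_fun [set: T] (F n)) -> (forall n x, (0 <= F n x)%E) ->
  measurable_fun [set: T] h -> (forall x, (0 <= h x)%E) ->
  {ae mu, forall x, F n x @[n --> \oo] --> h x} ->
  (forall n, (\int[mu]_x F n x <= C)%E) -> (\int[mu]_x h x <= C)%E.
Proof.
move=> mF F0 mh h0 Fh FC.
rewrite (@ae_eq_integral _ _ _ mu setT (fun x => limn_einf (F ^~ x)))//; last 2 first.
- rewrite /limn_einf; apply: measurableT_comp => //.
  apply: (@measurable_fun_limn_esup _ _ _ _ (fun n x => (- F n x)%E)) => n.
  exact: measurableT_comp.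
- by apply: filterS Fh => x Fx _; have [-> _] := cvg_limn_einf_sup Fx.
apply: le_trans (fatou mu measurableT mF (fun n x _ => F0 n x)) _.
rewrite limn_einf_lim; apply: lime_le.
  exact: is_cvg_einfs.
apply: nearW => n; apply: le_trans (FC n).
by apply: ereal_inf_lbound; exists n => /=.
Qed.

(** Dominated convergence, used to pass to the limit in lower bounds of difference
    quotients and of masses. *)
Lemma dominated_ge (U : nat -> T -> R) u w (C : R) :
  (forall n, measurable_fun [set: T] (U n)) -> measurable_fun [set: T] u ->
  {ae mu, forall x, U n x @[n --> \oo] --> u x} -> L1 w ->
  {ae mu, forall x n, `|U n x| <= w x} ->
  (forall n, C <= mean (U n)) -> C <= mean u.
Proof.
move=> mU mu' Uu iw Uw CU.
have [iu _ cv] : [/\ L1 u,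
    [sequence \int[mu]_x (`|(U n x)%:E - (u x)%:E|)]_n @ \oo --> 0%E &
    [sequence \int[mu]_x ((U n x)%:E)]_n @ \oo --> (\int[mu]_x (u x)%:E)%E]%E.
  apply: (@dominated_convergence _ _ _ mu setT _ (fun n => EFin \o U n) (EFin \o u) (EFin \o w)) => //.
  - by move=> n; exact/measurable_EFinP.
  - exact/measurable_EFinP.
  - by apply: filterS Uu => x Ux _; apply: cvg_EFin => //; exact: nearW.
  - by apply: filterS Uw => x + n _; rewrite lee_fin.
have iU n : L1 (U n).
  by apply: (@ae_le_L1 _ w) => //; apply: filterS Uw.
rewrite -lee_fin EFin_mean//.
apply: (lee_cvg_to (cvg_cst _) cv); apply: nearW => n /=.
by rewrite -EFin_mean// lee_fin.
Qed.

Lemma integral_or_pinftyE h : mu.-integrable [set: T] h ->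
  integral_or_pinfty mu h = (\int[mu]_x h x)%E.
Proof.
move=> ih; rewrite /integral_or_pinfty ifF//; apply/negbTE.
by rewrite negb_and (lt_eqF (integral_funepos_lt_pinfty measurableT ih)).
Qed.

Lemma integral_or_pinfty_ae h u : measurable_fun [set: T] h -> L1 u ->
  {ae mu, forall x, h x = (u x)%:E} -> integral_or_pinfty mu h = (mean u)%:E.
Proof.
move=> mh iu hu.
have E : ae_eq mu [set: T] h (EFin \o u) by apply: filterS hu => x + _.
rewrite integral_or_pinftyE; first rewrite (ae_eq_integral (EFin \o u)) ?EFin_mean//.
  exact: measurable_int iu.
apply/integrableP; split => //; have /integrableP[mu' iu'] := iu.
rewrite (ae_eq_integral (abse \o (EFin \o u)))//.
- exact: measurableT_comp.
- exact: measurableT_comp.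
- by apply: filterS E => x + xT => /(_ xT) /= ->.
Qed.

(** An integrable minorant rules out the convention +oo - oo; a value below +oo then
    forces integrability. *)
Lemma integral_or_pinfty_fin h w : measurable_fun [set: T] h -> L1 w ->
  {ae mu, forall x, ((w x)%:E <= h x)%E} ->
  (integral_or_pinfty mu h < +oo)%E ->
  [/\ L1 (fine \o h), {ae mu, forall x, h x = (fine (h x))%:E} &
      integral_or_pinfty mu h = (mean (fine \o h))%:E].
Proof.
move=> mh iw wh Hfin.
have hN : (\int[mu]_x h^\- x < +oo)%E.
  apply: le_lt_trans (integral_funeneg_lt_pinfty measurableT iw).
  apply: ae_ge0_le_integral => //.
  - exact: measurable_funeneg.
  - by apply: measurable_funeneg; exact: measurable_int iw.
  - apply: filterS wh => x wh _; rewrite !funenegE.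
    by rewrite ge_max !le_max leeN2 wh lexx orbT.
have hP : (\int[mu]_x h^\+ x < +oo)%E.
  move: Hfin; rewrite /integral_or_pinfty [X in _ && X]lt_eqF// andbF.
  rewrite integralE => H.
  rewrite ltNge leye_eq; apply/negP => /eqP E; move: H; rewrite E.
  by rewrite addye// eqe_oppLR/= lt_eqF.
have ih : mu.-integrable [set: T] h.
  apply/integrableP; split => //.
  have -> : (fun x => `|h x|)%E = (h^\+ \+ h^\-)%E by rewrite -fune_abse.
  rewrite ge0_integralD//; last 2 first.
  - exact: measurable_funepos.
  - exact: measurable_funeneg.
  exact: lte_add_pinfty.
have hE : {ae mu, forall x, h x = (fine (h x))%:E}.
  by apply: filterS (integrable_ae measurableT ih) => x /(_ I) /fineK.
have ifh : L1 (fine \o h).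
  apply/integrableP; split.
    by apply/measurable_EFinP; exact: measurableT_comp.
  have /integrableP[_] := ih; rewrite (ae_eq_integral (abse \o (EFin \o (fine \o h))))//.
  - exact: measurableT_comp.
  - apply: measurableT_comp => //; apply/measurable_EFinP; exact: measurableT_comp.
  - by apply: filterS hE => x xE _ /=; rewrite [in LHS]xE.
split => //; exact: integral_or_pinfty_ae.
Qed.

Lemma integral_or_pinfty_ge h w : measurable_fun [set: T] h -> L1 w ->
  {ae mu, forall x, ((w x)%:E <= h x)%E} -> ((mean w)%:E <= integral_or_pinfty mu h)%E.
Proof.
move=> mh iw wh; rewrite leNgt; apply/negP => Hlt.
have Hfin := lt_trans Hlt (ltry _).
have [ih hE E] := integral_or_pinfty_fin mh iw wh Hfin.
move: Hlt; rewrite E lte_fin ltNge => /negP; apply; apply: ae_le_mean => //.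
by apply: filterS2 wh hE => x; rewrite /= => /[swap] {1}->; rewrite lee_fin.
Qed.

Lemma integral_or_pinfty_le h w u : measurable_fun [set: T] h -> L1 w -> L1 u ->
  {ae mu, forall x, ((w x)%:E <= h x)%E} -> {ae mu, forall x, (h x <= (u x)%:E)%E} ->
  (integral_or_pinfty mu h <= (mean u)%:E)%E.
Proof.
move=> mh Lw Lu wh hu.
have hE : {ae mu, forall x, h x = (fine (h x))%:E}.
  apply: filterS2 wh hu => x wx xu; rewrite fineK// fin_real//.
  by rewrite (lt_le_trans _ wx) ?ltNyr// (le_lt_trans xu) ?ltry.
have Lh : L1 (fine \o h).
  apply: (@ae_sandwich_L1 w _ u) => //; first exact: measurableT_comp.
    by apply: filterS2 wh hE => x; rewrite /= => /[swap] {1}->; rewrite lee_fin.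
  by apply: filterS2 hu hE => x; rewrite /= => /[swap] {1}->; rewrite lee_fin.
rewrite (integral_or_pinfty_ae mh Lh hE) lee_fin; apply: ae_le_mean => //.
by apply: filterS2 hu hE => x; rewrite /= => /[swap] {1}->; rewrite lee_fin.
Qed.

End integration.

(** * The divergence generator and its conjugate *)

(** The inverse of the derivative of f, continued by 0 below its range: for tau < c
    this is the point where s tau - f s is maximal over s >= 0, hence the derivative
    of the conjugate. *)
Definition derive1_inv {R : realType} (f : R -> R) (tau : R) : R :=
  xget 0 [set s : R | 0 < s /\ derive1 f s = tau].

Section worst_case_model.
Context {R : realType} (f : R -> R) (c : R).
Context (f_convex : strictly_convex_pos f).
Context (f_diff : forall s : R, 0 < s -> derivable f s 1).
Context (f1 : f 1 = 0).
Context (f_slope : f s / s @[s --> +oo] --> c).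

Local Notation df := (derive1 f).

Lemma convex_le (x y t : R) : 0 < x -> 0 < y -> 0 < t < 1 ->
  f (t * x + (1 - t) * y) <= t * f x + (1 - t) * f y.
Proof.
move=> x0 y0 t01; have [->|xy] := eqVneq x y.
  by rewrite -!mulrDl addrC subrK !mul1r.
exact/ltW/f_convex.
Qed.

(** The difference quotient of a convex function towards y is at most its increment. *)
Lemma tangent_le (x y : R) : 0 < x -> 0 < y -> f x + df x * (y - x) <= f y.
Proof.
move=> x0 y0.
have dx : differentiable f x by apply/derivable1_diffP/f_diff.
have dE : 'D_(y - x) f x = df x * (y - x).
  rewrite deriveE// (deriv1E (f_diff x0)).
  by rewrite -[LHS]/((y - x) * df x) mulrC.
have : h^-1 *: (f (h *: (y - x) + x) - f x) @[h --> 0^'] --> df x * (y - x).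
  by rewrite -dE; exact: diff_derivable.
move=> /cvg_dnbhs_at_right cv.
rewrite addrC -lerBrDr; apply: (cvgr_to_le cv).
near=> h; rewrite -[_ *: _]/(h^-1 * _) ler_pdivrMl//.
have -> : h *: (y - x) + x = h * y + (1 - h) * x by rewrite -[_ *: _]/(h * _); ring.
have h01 : 0 < h < 1 by apply/andP; split; near: h;
  [exact: nbhs_right_gt|exact: nbhs_right_lt].
have := convex_le y0 x0 h01; lra.
Unshelve. all: by end_near. Qed.

Lemma tangent_lt (x y : R) : 0 < x -> 0 < y -> x != y ->
  f x + df x * (y - x) < f y.
Proof.
move=> x0 y0 xy.
have z0 : 0 < 2^-1 * x + (1 - 2^-1) * y by lra.
have h01 : 0 < (2^-1 : R) < 1 by apply/andP; split; lra.
have := f_convex x0 y0 xy h01; have := tangent_le x0 z0; lra.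
Qed.

Lemma derive1_lt (x y : R) : 0 < x -> x < y -> df x < df y.
Proof.
move=> x0 xy; have y0 := lt_trans x0 xy.
have := tangent_lt x0 y0 (negbT (lt_eqF xy)).
have := tangent_lt y0 x0 (negbT (gt_eqF xy)); nra.
Qed.

Lemma derive1_ltE (x y : R) : 0 < x -> 0 < y -> (df x < df y) = (x < y).
Proof.
move=> x0 y0; apply/idP/idP => [|xy]; last exact: derive1_lt.
by apply: contraTT; rewrite -!leNgt le_eqVlt => /predU1P[->//|/(derive1_lt y0)/ltW].
Qed.

Lemma derive1_leE (x y : R) : 0 < x -> 0 < y -> (df x <= df y) = (x <= y).
Proof. by move=> x0 y0; rewrite !leNgt derive1_ltE. Qed.

Lemma derive1_inj (x y : R) : 0 < x -> 0 < y -> df x = df y -> x = y.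
Proof.
move=> x0 y0 xy; apply/eqP.
by rewrite eq_le -(derive1_leE x0 y0) -(derive1_leE y0 x0) xy lexx.
Qed.

Lemma cvg_add_divy (a b : R) : a + b / t @[t --> +oo] --> a.
Proof.
rewrite -[X in _ --> X]addr0 -(mulr0 b).
apply: cvgD; first exact: cvg_cst.
apply: cvgM; first exact: cvg_cst.
apply/gtr0_cvgV0; last exact: cvg_id.
exact: nbhs_pinfty_gt.
Qed.

(** The tangent at s + 1 stays below f, so its slope is at most the limit of f t / t. *)
Lemma derive1_lt_slope (s : R) : 0 < s -> df s < c.
Proof.
move=> s0; apply: (@lt_le_trans _ _ (df (s + 1))).
  by apply: derive1_lt; rewrite ?ltrDl.
have s10 : 0 < s + 1 by rewrite addr_gt0.
set r := s + 1.
have cvr := @cvg_add_divy (df r) (f r - df r * r).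
apply: (ler_cvg_to cvr f_slope).
near=> t; have t0 : 0 < t by near: t; exact: nbhs_pinfty_gt.
rewrite ler_pdivlMr// mulrDl mulfVK ?gt_eqF//.
have := tangent_le s10 t0; rewrite -/r; lra.
Unshelve. all: by end_near. Qed.

(** Were the derivative bounded by tau, f would grow at most like tau t. *)
Lemma slope_derive1 (tau : R) : tau < c -> exists2 s : R, 0 < s & tau < df s.
Proof.
move=> tc; apply: contrapT => nex.
have le s : 0 < s -> df s <= tau.
  by move=> s0; rewrite leNgt; apply/negP => ts; apply: nex; exists s.
suff : c <= tau by rewrite leNgt tc.
have cvr := @cvg_add_divy tau (- tau).
apply: (ler_cvg_to f_slope cvr).
near=> t; have t0 : 0 < t by near: t; exact: nbhs_pinfty_gt.
have t1 : 1 < t by near: t; exact: nbhs_pinfty_gt.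
rewrite ler_pdivrMr// mulrDl mulfVK ?gt_eqF//.
have := tangent_le t0 ltr01; have := le _ t0; rewrite f1; nra.
Unshelve. all: by end_near. Qed.

Lemma derive1_stationary (S tau : R) : 0 < S ->
  (forall t : R, 0 < t -> t * tau - f t <= S * tau - f S) -> df S = tau.
Proof.
move=> S0 H.
have dg (t : R) : 0 < t -> is_derive t 1 (fun t => t * tau - f t) (tau - df t).
  move=> t0; have := derivableP (f_diff t0); rewrite -derive1E => ?.
  apply: is_derive_eq; rewrite -?[_ *: _]/(_ * _); ring.
have := @derive1_at_max R (fun t => t * tau - f t) (S/2) (S*2) S _ _ _ _.
case=> //.
- lra.
- move=> t; rewrite in_itv/= => /andP[tS _]; apply: ex_derive; apply: dg; lra.
- rewrite in_itv/=; lra.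
- by move=> t; rewrite in_itv/= => /andP[tS _]; apply: H; lra.
by move=> _; case: (dg S S0) => _ -> /eqP; rewrite subr_eq0 => /eqP.
Qed.

(** The derivative is not assumed continuous; tau is reached at an interior minimum
    of f t - t tau on a segment at whose ends the derivative lies on both sides of
    tau. *)
Lemma derive1_surj (e tau : R) : 0 < e -> df e <= tau -> tau < c ->
  exists2 S : R, e <= S & df S = tau.
Proof.
move=> e0; rewrite le_eqVlt => /predU1P[<- _|et tc]; first by exists e.
have [N N0 tN] := slope_derive1 tc.
have eN : e < N by rewrite -derive1_ltE// (lt_trans et).
pose g (t : R) := f t - t * tau.
have dg (t : R) : 0 < t -> is_derive t 1 g (df t - tau).
  move=> t0; have := derivableP (f_diff t0); rewrite -derive1E => ?.
  apply: is_derive_eq; rewrite -?[_ *: _]/(_ * _); ring.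
have [S SeN Smin] : exists2 S, S \in `[e, N] & forall t : R, t \in `[e, N] -> g S <= g t.
  apply: EVT_min; first exact/ltW.
  apply: derivable_within_continuous => t; rewrite in_itv/= => /andP[et' _].
  by apply: ex_derive; apply: dg; exact: lt_le_trans et'.
move: SeN; rewrite in_itv/= => /andP[eS SN].
have S0 : 0 < S := lt_le_trans e0 eS.
exists S => //; apply: derive1_stationary => // t t0.
have [te|et'] := ltP t e.
  have := Smin e; rewrite in_itv/= lexx (ltW eN) /g => /(_ isT).
  have := tangent_le e0 t0; nra.
have [tN'|Nt] := leP t N.
  by have := Smin t; rewrite in_itv/= et' tN' /g => /(_ isT); lra.
have := Smin N; rewrite in_itv/= lexx (ltW eN) /g => /(_ isT).
have := tangent_le N0 t0; nra.
Qed.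

Local Notation psi := (derive1_inv f).

Lemma fext_gt0 (s : R) : 0 < s -> fext f s = (f s)%:E.
Proof. by move=> s0; rewrite /fext ltNge ltW//= gt_eqF. Qed.

Lemma fext_lt0 (s : R) : s < 0 -> fext f s = +oo%E.
Proof. by move=> s0; rewrite /fext s0. Qed.

(** Subtracting the tangent slope at 1 makes f nonincreasing on (0, 1), so the limit
    exists in the extended line. *)
Lemma fext0_cvg : (f t)%:E @[t --> 0^'+] --> fext f 0.
Proof.
suff : cvg ((f t)%:E @[t --> 0^'+]) by rewrite /fext ltxx eqxx.
have ni : {in `]0, 1[ &, nonincreasing_fun (fun t => (f t - df 1 * t)%:E)}.
  move=> s t; rewrite !in_itv/= => /andP[s0 s1] /andP[t0 t1] st.
  have := tangent_le t0 s0; have := derive1_lt t0 t1; rewrite lee_fin; nra.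
have cg := @nonincreasing_at_right_cvge R _ 0 (BLeft 1) (ltr01 : (BRight 0 < BLeft 1)%O) ni.
have ch : (df 1 * t)%:E @[t --> 0^'+] --> 0%:E.
  apply: cvg_EFin; first exact: nearW.
  have : df 1 * t @[t --> 0] --> df 1 * 0 by apply: cvgM; [exact: cvg_cst|exact: cvg_id].
  by rewrite mulr0; exact: cvg_at_right_filter.
apply/cvg_ex; eexists.
have := cvgeD _ cg ch.
rewrite fin_num_adde_defl// => /(_ _ isT).
by apply: cvg_trans; apply: near_eq_cvg; near=> t; rewrite /= -EFinD subrK.
Unshelve. all: by end_near. Qed.

(** Lower bounds of the value at 0 from affine minorants near 0; the value may be +oo. *)
Lemma fext0_ge (tau C : R) : (\forall t \near 0^'+, t * tau - f t <= C) ->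
  ((- C)%:E <= fext f 0)%E.
Proof.
move=> H.
have ch : (t * tau - C)%:E @[t --> 0^'+] --> (- C)%:E.
  apply: cvg_EFin; first exact: nearW.
  have : t * tau - C @[t --> 0] --> 0 * tau - C.
    by apply: cvgB; [apply: cvgM; [exact: cvg_id|exact: cvg_cst]|exact: cvg_cst].
  by rewrite mul0r sub0r; exact: cvg_at_right_filter.
apply: (lee_cvg_to ch fext0_cvg); near=> t.
rewrite lee_fin; suff : t * tau - f t <= C by lra.
by near: t.
Unshelve. all: by end_near. Qed.

Lemma fext0_le (tau D : R) : (\forall t \near 0^'+, f t <= t * tau + D) ->
  (fext f 0 <= D%:E)%E.
Proof.
move=> H.
have ch : (t * tau + D)%:E @[t --> 0^'+] --> D%:E.
  apply: cvg_EFin; first exact: nearW.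
  have : t * tau + D @[t --> 0] --> 0 * tau + D.
    by apply: cvgD; [apply: cvgM; [exact: cvg_id|exact: cvg_cst]|exact: cvg_cst].
  by rewrite mul0r add0r; exact: cvg_at_right_filter.
apply: (lee_cvg_to fext0_cvg ch); near=> t; rewrite lee_fin.
by near: t.
Unshelve. all: by end_near. Qed.

Lemma psiP (tau : R) : (0 < psi tau /\ df (psi tau) = tau) \/ psi tau = 0.
Proof.
have [ex|nex] := pselect (exists s : R, [set s | 0 < s /\ df s = tau] s).
  by left; exact: (xgetPex 0 ex).
by right; apply: xgetPN => s sP; apply: nex; exists s.
Qed.

Lemma psi_ge0 (tau : R) : 0 <= psi tau.
Proof. by case: (psiP tau) => [[/ltW]|->]. Qed.

Lemma psi_derive1 (s : R) : 0 < s -> psi (df s) = s.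
Proof.
move=> s0; apply: xget_unique => //= t [t0 ts].
exact: derive1_inj.
Qed.

(** The Galois connection between the derivative of f and its inverse, from which
    monotonicity, continuity and the limits at both ends follow. *)
Lemma psi_leE (s tau : R) : 0 < s -> tau < c -> (s <= psi tau) = (df s <= tau).
Proof.
move=> s0 tc; apply/idP/idP => [|st].
  case: (psiP tau) => [[p0 pE]|->]; last by rewrite leNgt s0.
  by rewrite -{2}pE derive1_leE.
have [S sS <-] := derive1_surj s0 st tc.
by rewrite psi_derive1// (lt_le_trans s0).
Qed.

Lemma psi_ltE (s tau : R) : 0 < s -> tau < c -> (psi tau < s) = (tau < df s).
Proof. by move=> s0 tc; rewrite !ltNge psi_leE. Qed.

Lemma psi_le (t1 t2 : R) : t1 <= t2 -> t2 < c -> psi t1 <= psi t2.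
Proof.
move=> t12 t2c; case: (psiP t1) => [[p0 pE]|->]; last exact: psi_ge0.
by rewrite psi_leE// pE.
Qed.

(** This is where differentiability of f matters: two slopes at the same positive
    point coincide. *)
Lemma psi_inj (t1 t2 : R) : 0 < psi t1 -> psi t1 = psi t2 -> t1 = t2.
Proof.
move=> p0 E; case: (psiP t1) => [[_ <-]|p00]; last by rewrite p00 ltxx in p0.
rewrite E; case: (psiP t2) => [[_ ->]//|p00].
by rewrite E p00 ltxx in p0.
Qed.

(** Strict monotonicity of the derivative excludes jumps of its inverse. *)
Lemma psi_continuous (tau : R) : tau < c -> psi t @[t --> tau] --> psi tau.
Proof.
move=> tc; apply/cvgrPdist_le => e e0.
have pe0 : 0 < psi tau + e by rewrite ltr_wpDl ?psi_ge0.
have tpe : tau < df (psi tau + e) by rewrite -psi_ltE// ltrDl.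
have low : \forall t \near tau, psi tau - e <= psi t.
  have [pe|pe] := leP (psi tau - e) 0.
    by near=> t; apply: le_trans pe _; exact: psi_ge0.
  have pet : df (psi tau - e) < tau.
    have -> : tau = df (psi tau).
      by case: (psiP tau) => [[_ //]|p0]; move: pe; rewrite p0 sub0r oppr_gt0 ltNge ltW.
    by apply: derive1_lt => //; rewrite psi_derive1 ?gtrBl//; lra.
  near=> t; have tc' : t < c by near: t; exact: lt_nbhsl.
  rewrite psi_leE//; apply: ltW; near: t; exact: lt_nbhsr.
near=> t; have tc' : t < c by near: t; exact: lt_nbhsl.
have : psi t < psi tau + e by rewrite psi_ltE//; near: t; exact: lt_nbhsl.
have : psi tau - e <= psi t by near: t.
rewrite ler_norml; lra.
Unshelve. all: by end_near. Qed.

Local Notation phi := (fun tau => psi tau * tau - fine (fext f (psi tau))).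

(** At a positive stationary point the tangent is the supporting line.  If there is
    none, the derivative of f exceeds tau everywhere, so s tau - f s decreases and
    its supremum is the limit at 0, which must then be finite. *)
Lemma fext_psi_conj (tau : R) : tau < c ->
  fext f (psi tau) \is a fin_num /\
  forall s : R, ((s * tau)%:E - fext f s <= (phi tau)%:E)%E.
Proof.
move=> tc; have [p0|p0] : 0 < psi tau \/ psi tau = 0.
  by case: (psiP tau) => [[]|]; [left|right].
- have dp : df (psi tau) = tau by case: (psiP tau) => [[]//|E]; rewrite E ltxx in p0.
  have H (t : R) : 0 < t -> t * tau - f t <= psi tau * tau - f (psi tau).
    by move=> t0; have := tangent_le p0 t0; rewrite dp; lra.
  rewrite fext_gt0//; split => // s /=; have [s0|s0|->] := ltrgt0P s.
  + by rewrite fext_gt0// lee_fin H.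
  + by rewrite fext_lt0//= addeNy leNye.
  + rewrite mul0r sub0e leeNl -EFinN.
    apply: (@fext0_ge tau); near=> t; apply: H.
    by near: t; exact: nbhs_right_gt.
- have H (s : R) : 0 < s -> (fext f 0 <= (f s - s * tau)%:E)%E.
    move=> s0; apply: (@fext0_le tau); near=> t.
    have t0 : 0 < t by near: t; exact: nbhs_right_gt.
    have ts : t < s by near: t; exact: nbhs_right_lt.
    have := tangent_le t0 s0; have : tau < df t by rewrite -psi_ltE// p0.
    nra.
  have fin0 : fext f 0 \is a fin_num.
    rewrite fin_real//; apply/andP; split; last first.
      by apply: le_lt_trans (H 1 ltr01) _; rewrite ltry.
    apply: lt_le_trans (@fext0_ge (df 1) (df 1) _); first by rewrite ltNyr.
    near=> t; have t0 : 0 < t by near: t; exact: nbhs_right_gt.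
    by have := tangent_le ltr01 t0; rewrite f1; lra.
  rewrite p0; split => // s; rewrite mul0r sub0r EFinN fineK//.
  have [s0|s0|->] := ltrgt0P s.
  + rewrite fext_gt0// -EFinB leeNr -EFinN.
    apply: le_trans (H _ s0) _; rewrite lee_fin; lra.
  + by rewrite fext_lt0//= addeNy leNye.
  + by rewrite mul0r sub0e.
Unshelve. all: by end_near. Qed.

Lemma fext_psi_fin (tau : R) : tau < c -> fext f (psi tau) \is a fin_num.
Proof. by case/fext_psi_conj. Qed.

Lemma fconjE (tau : R) : tau < c -> fconj f tau = (phi tau)%:E.
Proof.
move=> tc; have [fin H] := fext_psi_conj tc.
apply/eqP; rewrite eq_le; apply/andP; split.
  by apply: ge_ereal_sup => _ [s _ <-]; exact: H.
apply: ereal_sup_ubound; exists (psi tau) => //.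
by rewrite EFinB fineK.
Qed.

Lemma fenchel_young (s tau : R) : ((s * tau)%:E - fext f s <= fconj f tau)%E.
Proof. by apply: ereal_sup_ubound; exists s. Qed.

(** The tangent at s, evaluated at 1 where f vanishes. *)
Lemma f_le_slope (s : R) : 1 < s -> f s <= c * (s - 1).
Proof.
move=> s1; have s0 : 0 < s := lt_trans ltr01 s1.
have := tangent_le s0 ltr01; have := derive1_lt_slope s0; rewrite f1; nra.
Qed.

Lemma fconj_pinfty (tau : R) : c < tau -> fconj f tau = +oo%E.
Proof.
move=> ct; apply/eqyP => A A0.
pose s := 1 + `|A - c| / (tau - c) + 1.
have s1 : 1 < s.
  by rewrite /s -addrA ltrDl ltr_wpDl// divr_ge0// ?subr_ge0 ?ltW.
apply: le_trans (fenchel_young s tau).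
rewrite fext_gt0 ?(lt_trans ltr01)// -EFinB lee_fin.
have := f_le_slope s1.
have : (s - 2) * (tau - c) = `|A - c|.
  by rewrite /s (_ : 1 + _ + 1 - 2 = `|A - c| / (tau - c)); [rewrite mulfVK ?gt_eqF// subr_gt0|ring].
have := ler_norm (A - c); nra.
Qed.

(** Equality in Fenchel's inequality makes s a maximum of t tau - f t: a stationary
    point if s > 0, and excluded by strict convexity if s = 0 but the stationary
    point is positive. *)
Lemma fenchel_young_eq (s tau : R) : tau < c -> 0 <= s ->
  (fconj f tau <= (s * tau)%:E - fext f s)%E -> s = psi tau.
Proof.
move=> tc; rewrite le_eqVlt => /predU1P[<-|s0] H; last first.
  suff <- : df s = tau by rewrite psi_derive1.
  apply: derive1_stationary => // t t0.
  have := le_trans (fenchel_young t tau) H.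
  by rewrite !fext_gt0// -!EFinB lee_fin.
case: (psiP tau) => [[S0 dS]|->//].
set S := psi tau in S0 dS *.
have h0 : 0 < S / 2 by lra.
have hS : S / 2 < S by lra.
have lt1 := tangent_lt S0 h0 (negbT (gt_eqF hS)).
have lt2 := derive1_lt h0 hS; rewrite dS in lt1 lt2.
have : ((f (S / 2) - S / 2 * tau)%:E <= fext f 0)%E.
  rewrite -[X in X%:E]opprK; apply: (@fext0_ge tau); near=> t.
  have t0 : 0 < t by near: t; exact: nbhs_right_gt.
  have tS : t < S / 2 by near: t; exact: nbhs_right_lt.
  by have := tangent_le h0 t0; nra.
have := le_trans (fenchel_young S tau) H.
rewrite mul0r sub0e fext_gt0// -EFinB leeNr -EFinN => le1 le2.
by have := le_trans le2 le1; rewrite lee_fin; lra.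
Unshelve. all: by end_near. Qed.

Lemma fconj_subgradient (tau sigma : R) : tau < c ->
  ((phi tau + psi tau * (sigma - tau))%:E <= fconj f sigma)%E.
Proof.
move=> tc; have := fenchel_young (psi tau) sigma.
rewrite -{1}(fineK (fext_psi_fin tc)) -EFinB.
by congr (_ <= _)%E; congr EFin; ring.
Qed.

(** The subgradients at tau and at tau + h enclose the difference quotient, and they
    come together by continuity. *)
Lemma fconj_diff_cvg (tau : R) : tau < c ->
  h^-1 *: (fine (fconj f (h + tau)) - fine (fconj f tau)) @[h --> 0^'] --> psi tau.
Proof.
move=> tc; apply/cvgrPdist_le => e e0.
have ctau : h + tau @[h --> 0^'] --> tau.
  apply: cvg_within_filter.
  have : h + tau @[h --> 0] --> 0 + tau by apply: cvgD; [exact: cvg_id|exact: cvg_cst].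
  by rewrite add0r.
have cvp : psi (h + tau) @[h --> 0^'] --> psi tau.
  apply: (@cvg_comp _ _ _ (fun h => h + tau) psi _ (nbhs tau)); last exact: psi_continuous.
  exact: ctau.
have cp : \forall h \near 0^', `|psi tau - psi (h + tau)| <= e.
  by move/cvgrPdist_le : cvp; exact.
near=> h.
have hc : h + tau < c.
  by near: h; apply: (cvgr_lt _ ctau).
have h0 : h != 0 by near: h; exact: nbhs_dnbhs_neq.
have : `|psi tau - psi (h + tau)| <= e by near: h.
rewrite !fconjE//=.
have := @fconj_subgradient tau (h + tau) tc.
have := @fconj_subgradient (h + tau) tau hc.
rewrite !fconjE//= !lee_fin.
set p1 := psi tau; set p2 := psi _.
set u := p1 * tau - _; set v := p2 * (h + tau) - _ => le1 le2.
rewrite -[_ *: _]/(h^-1 * (v - u)).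
have -> : p1 - h^-1 * (v - u) = (p1 * h - (v - u)) / h.
  by rewrite mulrBl mulfK// [_^-1 * _]mulrC.
rewrite normrM normfV ler_pdivrMr ?normr_gt0// => le3.
have : `|p1 * h - (v - u)| <= `|(p1 - p2) * h|.
  rewrite ler0_norm; last by move: le2; lra.
  rewrite -normrN; apply: le_trans (ler_norm _).
  move: le1; lra.
by move/le_trans; apply; rewrite normrM ler_wpM2r.
Unshelve. all: by end_near. Qed.

Lemma dfconjE (tau : R) : tau < c -> dfconj f c tau = (psi tau)%:E.
Proof.
by move=> tc; rewrite /dfconj tc; congr EFin; apply: cvg_lim => //; exact: fconj_diff_cvg.
Qed.

Lemma dfconj_pinfty (tau : R) : c <= tau -> dfconj f c tau = +oo%E.
Proof.
move=> ct; rewrite /dfconj ltNge ct/=; apply: cvg_lim => //.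
apply/cvgeyPge => A; near=> t.
have tc : t < c by near: t; exact: nbhs_left_lt.
have := dfconjE tc; rewrite /dfconj tc => ->; rewrite lee_fin.
have A0 : 0 < `|A| + 1 by rewrite ltr_wpDl.
apply: (@le_trans _ _ (`|A| + 1)); first by rewrite (le_trans (ler_norm _))// lerDl.
rewrite psi_leE//; near: t; apply: nbhs_left_ge; exact: derive1_lt_slope.
Unshelve. all: by end_near. Qed.

Lemma dfconj_ge0 (tau : R) : (0 <= dfconj f c tau)%E.
Proof.
have [tc|ct] := ltP tau c; first by rewrite dfconjE// lee_fin psi_ge0.
by rewrite dfconj_pinfty.
Qed.

Lemma fext_ge_tangent (s : R) : ((df 1 * (s - 1))%:E <= fext f s)%E.
Proof.
have [s0|s0|->] := ltrgt0P s.
- by rewrite fext_gt0// lee_fin; have := tangent_le ltr01 s0; rewrite f1; lra.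
- by rewrite fext_lt0// leey.
- rewrite sub0r mulrN mulr1; apply: (@fext0_ge (df 1)); near=> t.
  have t0 : 0 < t by near: t; exact: nbhs_right_gt.
  by have := tangent_le ltr01 t0; rewrite f1; lra.
Unshelve. all: by end_near. Qed.

(** The derivative of f never exceeds c, so adding mass t costs at most c t. *)
Lemma fext_add_le (s t : R) : 0 <= s -> 0 <= t ->
  (fext f (s + t) <= fext f s + (c * t)%:E)%E.
Proof.
move=> s0; rewrite le_eqVlt => /predU1P[<-|t0]; first by rewrite addr0 mulr0 adde0.
have st0 : 0 < s + t by rewrite ltr_wpDl.
have dc := derive1_lt_slope st0.
rewrite (fext_gt0 st0); move: s0; rewrite le_eqVlt => /predU1P[s0|s0]; last first.
  by rewrite fext_gt0// lee_fin; have := tangent_le st0 s0; nra.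
rewrite -s0 !add0r in st0 dc *; rewrite -leeBlDr// -EFinB -[X in X%:E]opprK.
apply: (@fext0_ge c); near=> u.
have u0 : 0 < u by near: u; exact: nbhs_right_gt.
have ut : u < t by near: u; exact: nbhs_right_lt.
have := tangent_le st0 u0; nra.
Unshelve. all: by end_near. Qed.

(** Convexity towards the point 1, where f vanishes. *)
Lemma fext_mix_le (s t : R) : 0 <= s -> 0 < t < 1 ->
  (fext f ((1 - t) * s + t) <= (1 - t)%:E * fext f s)%E.
Proof.
move=> s0 /andP[t0 t1]; have u0 : 0 < 1 - t by rewrite subr_gt0.
have st0 : 0 < (1 - t) * s + t by rewrite ltr_wpDl// mulr_ge0// ltW.
rewrite (fext_gt0 st0); move: s0; rewrite le_eqVlt => /predU1P[s0|s0]; last first.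
  rewrite fext_gt0// lee_fin.
  have tt : 0 < 1 - t < 1 by rewrite u0 gtrBl.
  have := convex_le s0 ltr01 tt; rewrite f1 mulr0 addr0 mulr1.
  by rewrite subKr.
rewrite -s0 mulr0 add0r in st0 *; rewrite -lee_pdivrMl// -EFinM -[X in X%:E]opprK.
apply: (@fext0_ge (df t)); near=> u.
have u0' : 0 < u by near: u; exact: nbhs_right_gt.
have := tangent_le t0 u0'; have := tangent_le t0 ltr01; rewrite f1 => h1 h2.
suff : (1 - t)^-1 * f t <= f t - t * df t by lra.
rewrite mulrC ler_pdivrMr//; nra.
Unshelve. all: by end_near. Qed.

Lemma psi_derive1_1 : psi (df 1) = 1.
Proof. exact: psi_derive1. Qed.

Lemma phi_continuous (tau : R) : tau < c ->
  fine (fconj f t) @[t --> tau] --> fine (fconj f tau).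
Proof.
move=> tc; apply: differentiable_continuous; apply/derivable1_diffP.
rewrite /derivable; apply/cvg_ex; exists (psi tau).
under eq_fun do rewrite -[_ *: 1]/(_ * 1) mulr1.
exact: fconj_diff_cvg.
Qed.

Lemma measurable_fext : measurable_fun [set: R] (fext f).
Proof.
rewrite (_ : fext f = fun s : R => if 0 < s then (f s)%:E
    else if s == 0 then fext f 0 else +oo%E); last first.
  apply/funext => s; have [s0|s0|->] := ltrgt0P s; last by [].
    by rewrite fext_gt0.
  by rewrite fext_lt0// lt_eqF.
apply: measurable_fun_if => //.
- exact: measurable_fun_ltr.
- rewrite setTI; apply/measurable_EFinP.
  rewrite (_ : _ @^-1` _ = `]0, +oo[%classic); last first.
    by apply/seteqP; split => s /=; rewrite in_itv/= andbT.
  apply: open_continuous_measurable_fun => // s.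
  rewrite inE/= in_itv/= andbT => s0.
  by apply: differentiable_continuous; apply/derivable1_diffP/f_diff.
- apply: measurable_funTS; apply: measurable_fun_ifT => //.
  exact: measurable_fun_eqr.
Qed.

Lemma measurable_below (g : R -> R) (b : \bar R) :
  (forall t, t < c -> g u @[u --> t] --> g t) ->
  measurable_fun [set: R] (fun t => if t < c then (g t)%:E else b).
Proof.
move=> cg; apply: measurable_fun_if => //.
- exact: measurable_fun_ltr.
rewrite setTI; apply/measurable_EFinP.
rewrite (_ : _ @^-1` _ = `]-oo, c[%classic); last first.
  by apply/seteqP; split => s /=; rewrite in_itv/=.
apply: open_continuous_measurable_fun => // s.
by rewrite inE/= in_itv/=; exact: cg.
Qed.

Lemma measurable_fconj : measurable_fun [set: R] (fconj f).
Proof.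
rewrite (_ : fconj f = fun t : R => if t == c then fconj f c else
    if t < c then (fine (fconj f t))%:E else +oo%E).
  apply: measurable_fun_ifT => //; first exact: measurable_fun_eqr.
  by apply: measurable_below => t; exact: phi_continuous.
apply/funext => t; have [tc|tc|->] := ltrgtP t c; last by [].
  by rewrite fconjE.
by rewrite fconj_pinfty.
Qed.

Lemma measurable_dfconj : measurable_fun [set: R] (dfconj f c).
Proof.
rewrite (_ : dfconj f c = fun t : R => if t < c then (psi t)%:E else +oo%E).
  by apply: measurable_below => t; exact: psi_continuous.
apply/funext => t; have [tc|tc] := ltP t c; first by rewrite dfconjE.
by rewrite dfconj_pinfty.
Qed.

(** * The tilted densities *)

Lemma dfconj_le (y z : R) : y <= z -> (dfconj f c y <= dfconj f c z)%E.
Proof.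
move=> yz; have [zc|cz] := ltP z c; last by rewrite (dfconj_pinfty cz) leey.
by rewrite !dfconjE// ?lee_fin ?psi_le// (le_lt_trans yz).
Qed.

(** At c the value is the left limit +oo, so the derivative of the conjugate is left
    continuous there too; this makes the mass left continuous in the multipliers. *)
Lemma dfconj_left_cvg (u : nat -> R) (y : R) : (forall n, u n <= y) ->
  u n @[n --> \oo] --> y -> dfconj f c (u n) @[n --> \oo] --> dfconj f c y.
Proof.
move=> uy cu; have [yc|cy] := ltP y c.
  rewrite dfconjE//.
  rewrite (_ : (fun n => _) = (fun n => (psi (u n))%:E)); last first.
    by apply/funext => n; rewrite dfconjE// (le_lt_trans (uy n)).
  apply: cvg_EFin; first exact: nearW.
  exact: (cvg_comp _ _ cu (psi_continuous yc)).
rewrite dfconj_pinfty//; apply/cvgeyPge => A.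
have A0 : 0 < `|A| + 1 by rewrite ltr_wpDl.
have dA : df (`|A| + 1) < y by rewrite (lt_le_trans _ cy)// derive1_lt_slope.
near=> n.
have un : df (`|A| + 1) < u n by near: n; apply: (cvgr_gt _ cu).
apply: (@le_trans _ _ (`|A| + 1)%:E).
  by rewrite lee_fin (le_trans (ler_norm _))// lerDl.
have [uc|cu'] := ltP (u n) c; last by rewrite dfconj_pinfty// leey.
by rewrite dfconjE// lee_fin psi_leE// ltW.
Unshelve. all: by end_near. Qed.

Context {d : measure_display} {T : measurableType d}.
Context (mu : probability T R) (X : T -> R).
Context (mX : measurable_fun [set: T] X).
Context (X_inf : ess_inf mu (EFin \o X) = 0%E).
Context (b0_gt0 : (0 < \int[mu]_x (X x)%:E)%E).
Context (b0_ltM : (\int[mu]_x (X x)%:E < ess_sup mu (EFin \o X))%E).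

Local Notation L1 u := (mu.-integrable [set: T] (EFin \o u)).
Local Notation mean u := (\int[mu]_x u x).
Local Notation tau t1 t2 := (fun x : T => t1 + t2 * X x).
Local Notation dens t1 t2 := (ptheta f X c t1 t2).
Local Notation conj_at t1 t2 := (fun x : T => fine (fconj f (t1 + t2 * X x))).

Lemma X_ge0 : {ae mu, forall x, 0 <= X x}.
Proof.
have : {ae mu, forall x, (0 <= (EFin \o X) x)%E} by apply/ess_infP; rewrite X_inf.
by apply: filterS => x; rewrite /= lee_fin.
Qed.

Lemma measurable_X_lt (e : R) : measurable [set x | X x < e].
Proof.
rewrite -[X in measurable X]setTI.
have -> : [set x | X x < e] = X @^-1` `]-oo, e[%classic.
  by apply/seteqP; split => x /=; rewrite in_itv.
exact: mX.
Qed.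

(** All small values of X carry mass, since the essential infimum of X is 0. *)
Lemma X_lt_gt0 (e : R) : 0 < e -> (0 < mu [set x | (X x < e)%R])%E.
Proof.
move=> e0; rewrite lt0e measure_ge0 andbT; apply/eqP => mu0.
have : (e%:E <= ess_inf mu (EFin \o X))%E.
  apply/ess_infP; exists [set x | X x < e]; split => //.
    exact: measurable_X_lt.
  by move=> x /= /negP; rewrite lee_fin -ltNge.
by rewrite X_inf lee_fin leNgt e0.
Qed.

Lemma L1_X : L1 X.
Proof.
apply/integrableP; split; first exact/measurable_EFinP.
rewrite (ae_eq_integral (EFin \o X))//; last 3 first.
- by apply: measurableT_comp => //; exact/measurable_EFinP.
- exact/measurable_EFinP.
- by apply: filterS X_ge0 => x x0 _ /=; rewrite ger0_norm.
exact: lt_le_trans b0_ltM (leey _).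
Qed.

Lemma mean_X_gt0 : 0 < mean X.
Proof. by rewrite -lte_fin (EFin_mean L1_X). Qed.

Lemma measurable_tau (t1 t2 : R) : measurable_fun [set: T] (tau t1 t2).
Proof. by apply: measurable_funD => //; exact: measurable_funM. Qed.

Lemma measurable_dfconj_tau (t1 t2 : R) :
  measurable_fun [set: T] (fun x => dfconj f c (t1 + t2 * X x)).
Proof. exact: (measurableT_comp measurable_dfconj (measurable_tau t1 t2)). Qed.

Lemma measurable_fconj_tau (t1 t2 : R) :
  measurable_fun [set: T] (fun x => fconj f (t1 + t2 * X x)).
Proof. exact: (measurableT_comp measurable_fconj (measurable_tau t1 t2)). Qed.

Lemma measurable_dens (t1 t2 : R) : measurable_fun [set: T] (dens t1 t2).
Proof. exact: (measurableT_comp _ (measurable_dfconj_tau t1 t2)). Qed.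

Lemma dens_ge0 (t1 t2 : R) (x : T) : 0 <= dens t1 t2 x.
Proof. by apply: fine_ge0; exact: dfconj_ge0. Qed.

Lemma densE (t1 t2 : R) (x : T) : t1 + t2 * X x < c -> dens t1 t2 x = psi (t1 + t2 * X x).
Proof. by move=> tc; rewrite /ptheta dfconjE. Qed.

Lemma L1_tau (t1 t2 : R) : L1 (tau t1 t2).
Proof.
by apply: L1_D; [exact: L1_cst|apply: L1_Z; exact: L1_X].
Qed.

Lemma mean_tau (t1 t2 : R) : mean (tau t1 t2) = t1 + t2 * mean X.
Proof.
by rewrite mean_D ?mean_cst ?mean_Z//; [exact: L1_X|exact: L1_cst|apply: L1_Z; exact: L1_X].
Qed.

(** As X >= 0, the argument of the conjugate is largest where X vanishes. *)
Lemma tau_lt (t1 t2 : R) : t2 <= 0 -> t1 < c ->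
  {ae mu, forall x, t1 + t2 * X x <= t1 /\ t1 + t2 * X x < c}.
Proof.
move=> t20 t1c; apply: filterS X_ge0 => x x0.
have : t2 * X x <= 0 by exact: mulr_le0_ge0.
lra.
Qed.

(** The choice s = 1 in the supremum; it keeps K away from -oo. *)
Lemma fconj_ge_id (y : R) : (y%:E <= fconj f y)%E.
Proof.
have := fenchel_young 1 y; rewrite fext_gt0// f1.
by rewrite mul1r sube0.
Qed.

Lemma Kfun_ge (t1 t2 : R) (w : T -> R) : L1 w ->
  {ae mu, forall x, ((w x)%:E <= fconj f (t1 + t2 * X x))%E} ->
  ((mean w)%:E <= Kfun mu f X t1 t2)%E.
Proof. exact/integral_or_pinfty_ge/measurable_fconj_tau. Qed.

Lemma Kfun_fin (t1 t2 : R) : (Kfun mu f X t1 t2 < +oo)%E ->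
  [/\ L1 (conj_at t1 t2),
      {ae mu, forall x, fconj f (t1 + t2 * X x) = (conj_at t1 t2 x)%:E} &
      Kfun mu f X t1 t2 = (mean (conj_at t1 t2))%:E].
Proof.
apply: (integral_or_pinfty_fin (measurable_fconj_tau t1 t2) (L1_tau t1 t2)).
by apply: nearW => x; exact: fconj_ge_id.
Qed.

Lemma Kfun_mean (t1 t2 : R) : {ae mu, forall x, t1 + t2 * X x < c} ->
  L1 (conj_at t1 t2) -> Kfun mu f X t1 t2 = (mean (conj_at t1 t2))%:E.
Proof.
move=> tc Lc; apply: (integral_or_pinfty_ae (measurable_fconj_tau t1 t2) Lc).
by apply: filterS tc => x xc; rewrite fconjE.
Qed.

Lemma fconj_le (y z : R) : y <= z -> z < c -> fine (fconj f y) <= fine (fconj f z).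
Proof.
move=> yz zc; have yc := le_lt_trans yz zc.
have := @fconj_subgradient y z yc; rewrite !fconjE//= lee_fin.
have : 0 <= psi y * (z - y) by rewrite mulr_ge0 ?psi_ge0 ?subr_ge0.
lra.
Qed.

Lemma L1_conj_at (t1 t2 : R) : t2 <= 0 -> t1 < c -> L1 (conj_at t1 t2).
Proof.
move=> t20 t1c; have tlt := tau_lt t20 t1c.
apply: (@ae_sandwich_L1 _ _ _ mu (tau t1 t2) _ (fun=> fine (fconj f t1))).
- exact: (measurableT_comp _ (measurable_fconj_tau t1 t2)).
- exact: L1_tau.
- exact: L1_cst.
- apply: filterS tlt => x [_ xc]; have := fconj_ge_id (t1 + t2 * X x).
  by rewrite fconjE.
- by apply: filterS tlt => x [xt xc]; exact: fconj_le.
Qed.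

(** Where X is small the argument exceeds c, and this set has positive mass. *)
Lemma Kfun_pinfty (t1 t2 : R) : t2 <= 0 -> c < t1 -> Kfun mu f X t1 t2 = +oo%E.
Proof.
move=> t20 ct1; apply/eqP; rewrite -leye_eq leNgt; apply/negP => /Kfun_fin[_ [N [mN N0 sN]] _].
pose e := (t1 - c) / (1 - t2).
have d0 : 0 < 1 - t2 by lra.
have e0 : 0 < e by rewrite divr_gt0// subr_gt0.
have := X_lt_gt0 e0; rewrite ltNge => /negP; apply.
rewrite -N0; apply: le_measure; rewrite ?inE//; first exact: measurable_X_lt.
move=> x /= xe; apply: sN => /=.
suff /fconj_pinfty -> : c < t1 + t2 * X x by [].
have := xe; rewrite /e ltr_pdivlMr// => xe'.
have [x0|x0] := leP (X x) 0; first by have := mulr_le0 t20 x0; lra.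
nra.
Qed.

(** The last two conditions express that (c - t1) (1 - mass) = 0 with mass at most
    one: the first-order condition for minimising K(t1, t2) - t1 over t1 <= c. *)
Definition normalised (t1 t2 : R) : Prop :=
  [/\ t1 <= c, {ae mu, forall x, t1 + t2 * X x < c}, L1 (dens t1 t2),
      mean (dens t1 t2) <= 1 & t1 < c -> mean (dens t1 t2) = 1].

(** The derivative of the conjugate is +oo from c on, so a finite integral forces the
    argument below c almost everywhere. *)
Lemma dfconj_int_le (t1 t2 : R) : (\int[mu]_x dfconj f c (t1 + t2 * X x) < +oo)%E ->
  [/\ {ae mu, forall x, t1 + t2 * X x < c}, L1 (dens t1 t2) &
    (mean (dens t1 t2))%:E = (\int[mu]_x dfconj f c (t1 + t2 * X x))%E].
Proof.
move=> fin.
have inth : mu.-integrable [set: T] (fun x => dfconj f c (t1 + t2 * X x)).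
  apply/integrableP; split; first exact: measurable_dfconj_tau.
  under eq_integral do rewrite gee0_abs ?dfconj_ge0//.
  exact: fin.
have hfin := integrable_ae measurableT inth.
have tc : {ae mu, forall x, t1 + t2 * X x < c}.
  apply: filterS hfin => x /(_ I); rewrite ltNge; apply: contraL => ct.
  by rewrite dfconj_pinfty.
have E : ae_eq mu [set: T] (EFin \o dens t1 t2) (fun x => dfconj f c (t1 + t2 * X x)).
  by apply: filterS hfin => x /(_ I) xfin _; rewrite /= fineK.
have mD : measurable_fun [set: T] (EFin \o dens t1 t2) by apply/measurable_EFinP/measurable_dens.
have LD : L1 (dens t1 t2).
  apply/integrableP; split => //.
  rewrite (ae_eq_integral (fun x => dfconj f c (t1 + t2 * X x)))//.
  - exact: measurableT_comp.
  - exact: measurable_dfconj_tau.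
  - apply: filterS E => x /(_ I) E1 _.
    by rewrite -[LHS]/(`|(EFin \o dens t1 t2) x|)%E E1 gee0_abs// dfconj_ge0.
split => //; rewrite EFin_mean//; apply: ae_eq_integral => //.
exact: measurable_dfconj_tau.
Qed.

Lemma L1_dens (t1 t2 : R) : t2 <= 0 -> t1 < c -> L1 (dens t1 t2).
Proof.
move=> t20 t1c; apply: (@ae_le_L1 _ _ _ mu _ (fun=> psi t1)).
- exact: measurable_dens.
- exact: L1_cst.
- apply: filterS (tau_lt t20 t1c) => x [xt xc].
  by rewrite densE// ger0_norm ?psi_ge0// psi_le.
Qed.

Lemma mean_dens (t1 t2 : R) : t2 <= 0 -> t1 < c ->
  (mean (dens t1 t2))%:E = (\int[mu]_x dfconj f c (t1 + t2 * X x))%E.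
Proof.
move=> t20 t1c; rewrite EFin_mean; last exact: L1_dens.
apply: ae_eq_integral => //.
- by apply/measurable_EFinP/measurable_dens.
- exact: measurable_dfconj_tau.
- by apply: filterS (tau_lt t20 t1c) => x [_ xc] _ /=; rewrite densE// dfconjE.
Qed.

(** * Points minimising over the first multiplier *)

Lemma cvg_harmonicZ (a b : R) : a + b / n.+1%:R @[n --> \oo] --> a.
Proof.
rewrite -[X in _ --> X]addr0 -(mulr0 b).
by apply: cvgD; [exact: cvg_cst|apply: cvgM; [exact: cvg_cst|exact: cvg_harmonic]].
Qed.

Lemma divn_le (b : R) (n : nat) : 0 <= b -> 0 <= b / n.+1%:R <= b.
Proof.
move=> b0; rewrite divr_ge0//= ler_pdivrMr// ler_peMr//.
by rewrite ler1n.
Qed.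

(** The multiplier t1 is the largest at which the mass does not exceed one.  Fatou's
    lemma gives mass at most one at t1; if t1 < c, dominated convergence from the
    right gives mass at least one. *)
Lemma normalised_exists (t2 : R) : t2 <= 0 -> exists t1 : R, normalised t1 t2.
Proof.
move=> t20; pose N (t : R) := (\int[mu]_x dfconj f c (t + t2 * X x))%E.
have Nle (s t : R) : s <= t -> (N s <= N t)%E.
  move=> st; apply: ge0_le_integral => //.
  - by move=> x _; exact: dfconj_ge0.
  - exact: measurable_dfconj_tau.
  - exact: measurable_dfconj_tau.
  - by move=> x _; apply: dfconj_le; rewrite lerD2r.
pose A := [set t : R | t <= c /\ (N t <= 1)%E].
have a1c : df 1 < c := derive1_lt_slope ltr01.
have A1 : A (df 1).
  split; first exact: ltW.
  rewrite /N -mean_dens// lee_fin -[leRHS](mean_cst mu).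
  apply: ae_le_mean => //; [exact: L1_dens|exact: L1_cst|].
  apply: filterS (tau_lt t20 a1c) => x [xt xc].
  by rewrite densE// -[leRHS]psi_derive1_1 psi_le.
have hA : has_sup A by split; [exists (df 1)|exists c => t []].
pose t1 := sup A.
have t1c : t1 <= c by apply: ge_sup; [exists (df 1)|move=> t []].
have below (t : R) : t < t1 -> (N t <= 1)%E.
  move=> tt; have [s [sc Ns] ts] := sup_gt (proj1 hA) tt.
  exact: le_trans (Nle _ _ (ltW ts)) Ns.
have N1 : (N t1 <= 1)%E.
  apply: (@fatou_le _ _ _ mu
    (fun n x => dfconj f c ((t1 + (-1) / n.+1%:R) + t2 * X x))).
  - by move=> n; exact: measurable_dfconj_tau.
  - by move=> n x; exact: dfconj_ge0.
  - exact: measurable_dfconj_tau.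
  - by move=> x; exact: dfconj_ge0.
  - apply: nearW => x; apply: dfconj_left_cvg.
      by move=> n; rewrite lerD2r gerDl mulN1r oppr_le0.
    by apply: cvgD; [exact: cvg_harmonicZ|exact: cvg_cst].
  - by move=> n; apply: below; rewrite gtrDl mulN1r oppr_lt0.
have [tc LD mE] := dfconj_int_le (le_lt_trans N1 (ltry _)).
have m1 : mean (dens t1 t2) <= 1 by rewrite -lee_fin mE.
exists t1; split => // t1c'; apply/eqP; rewrite eq_le m1/=.
pose h := (c - t1) / 2; have h0 : 0 < h by rewrite divr_gt0// subr_gt0.
have hc : t1 + h < c by rewrite /h; lra.
clearbody h.
have hn (n : nat) : 0 < h / n.+1%:R <= h.
  by have /andP[_ ->] := @divn_le h n (ltW h0); rewrite divr_gt0.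
apply: (@dominated_ge _ _ _ mu (fun n => dens (t1 + h / n.+1%:R) t2) _ (fun=> psi (t1 + h))).
- by move=> n; exact: measurable_dens.
- exact: measurable_dens.
- apply: filterS tc => x xc; rewrite densE//.
  have cv : t1 + h / n.+1%:R + t2 * X x @[n --> \oo] --> t1 + t2 * X x.
    by apply: cvgD; [exact: cvg_harmonicZ|exact: cvg_cst].
  have := cvg_comp _ _ cv (psi_continuous xc).
  apply: cvg_trans; apply: near_eq_cvg; near=> n.
  by rewrite densE//; near: n; apply: (cvgr_lt _ cv).
- exact: L1_cst.
- have thc := tau_lt t20 hc.
  apply: filterS X_ge0 => x x0 n.
  have := hn n; set q := h / _ => /andP[q0 qh].
  have tx : t2 * X x <= 0 by exact: mulr_le0_ge0.
  rewrite densE; last by lra.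
  by rewrite ger0_norm ?psi_ge0// psi_le//; lra.
- move=> n; have /andP[] := hn n; set q := h / _ => q0 qh.
  have tn : t1 + q < c by lra.
  rewrite leNgt; apply/negP => lt1.
  suff : A (t1 + q) by move=> /(ub_le_sup (proj2 hA)); rewrite leNgt ltrDl q0.
  split; first exact: ltW.
  by rewrite /N -(mean_dens t20 tn) lee_fin ltW.
Unshelve. all: by end_near. Qed.

Lemma conj_subgradient_ae (t1 t2 s1 s2 : R) : {ae mu, forall x, t1 + t2 * X x < c} ->
  {ae mu, forall x, ((conj_at t1 t2 x + dens t1 t2 x * ((s1 - t1) + (s2 - t2) * X x))%:E
     <= fconj f (s1 + s2 * X x))%E}.
Proof.
apply: filterS => x xc; rewrite densE// fconjE//=.
apply: le_trans (fconj_subgradient (s1 + s2 * X x) xc).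
by rewrite lee_fin; lra.
Qed.

Section normalised_point.
Context (t1 t2 : R) (t2_lt0 : t2 < 0) (Hn : normalised t1 t2).

(** The subgradient at the point, evaluated with t1 lowered by one, bounds the
    conjugate by an integrable function even if t1 = c. *)
Lemma normalised_L1_conj : L1 (conj_at t1 t2).
Proof.
have [t1c tc LD _ _] := Hn.
have t1c' : t1 - 1 < c by lra.
have Ls := L1_conj_at (ltW t2_lt0) t1c'.
apply: (@ae_sandwich_L1 _ _ _ mu (tau t1 t2) _
  (fun x => conj_at (t1 - 1) t2 x + 1 * dens t1 t2 x)).
- exact: (measurableT_comp _ (measurable_fconj_tau t1 t2)).
- exact: L1_tau.
- by apply: L1_D => //; exact: L1_Z.
- by apply: filterS tc => x xc; have := fconj_ge_id (t1 + t2 * X x); rewrite fconjE.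
- have sg := @conj_subgradient_ae t1 t2 (t1 - 1) t2 tc.
  apply: filterS2 sg (tau_lt (ltW t2_lt0) t1c') => x + [_ xc].
  by rewrite (fconjE xc)/= lee_fin; lra.
Qed.

(** Although t2 cannot be raised at t1 = c, it can be raised by h if t1 is lowered by
    h: the increment of the conjugate, divided by h, dominates X D - D. *)
Lemma normalised_L1_XD : L1 (fun x => X x * dens t1 t2 x).
Proof.
have [t1c tc LD _ _] := Hn.
(* Half the distance to 0 keeps t2 + h negative. *)
have [h [h0 t2h]] : exists h : R, 0 < h /\ t2 + h <= 0.
  by exists (- t2 / 2); split; move: t2_lt0; lra.
have t1c' : t1 - h < c by lra.
have Ls := L1_conj_at t2h t1c'.
have Lc := normalised_L1_conj.
apply: (@ae_sandwich_L1 _ _ _ mu (fun=> 0) _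
  (fun x => dens t1 t2 x + h^-1 * (conj_at (t1 - h) (t2 + h) x - conj_at t1 t2 x))).
- by apply: measurable_funM => //; exact: measurable_dens.
- exact: L1_cst.
- by apply: L1_D => //; apply: L1_Z; exact: L1_B.
- by apply: filterS X_ge0 => x x0; rewrite mulr_ge0// dens_ge0.
- have sg := @conj_subgradient_ae t1 t2 (t1 - h) (t2 + h) tc.
  apply: filterS2 sg (tau_lt t2h t1c') => x + [_ xc].
  rewrite (fconjE xc)/= lee_fin => H.
  rewrite -lerBlDl -ler_pdivrMl ?invr_gt0// invrK.
  move: H; set u := fine _; set v := dens _ _ _; lra.
Qed.

Lemma normalised_Kfun : Kfun mu f X t1 t2 = (mean (conj_at t1 t2))%:E.
Proof. by have [_ tc _ _ _] := Hn; apply: Kfun_mean => //; exact: normalised_L1_conj. Qed.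

(** The integrated subgradient inequality of f^*.  The term in s1 - t1 is
    (s1 - t1) (mass - 1), which is nonnegative for s1 <= c by the condition
    of normalisation. *)
Lemma normalised_Kfun_ge (s1 s2 : R) : s2 <= 0 ->
  ((mean (conj_at t1 t2) - t1 + mean (fun x => X x * dens t1 t2 x) * (s2 - t2))%:E
   <= Kfun mu f X s1 s2 - s1%:E)%E.
Proof.
move=> s20; have [t1c tc LD m1 mE] := Hn.
have [s1c|cs1] := leP s1 c; last by rewrite Kfun_pinfty// leey.
rewrite leeBrDr//.
have Lc := normalised_L1_conj; have LX := normalised_L1_XD.
have sg := @conj_subgradient_ae t1 t2 s1 s2 tc.
pose w x := conj_at t1 t2 x + ((s1 - t1) * dens t1 t2 x + (s2 - t2) * (X x * dens t1 t2 x)).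
have Lw : L1 w by apply: L1_D => //; exact: L1_comb.
have := @Kfun_ge s1 s2 w Lw; rewrite mean_D ?mean_comb//; last exact: L1_comb.
have aew : {ae mu, forall x, ((w x)%:E <= fconj f (s1 + s2 * X x))%E}.
  by apply: filterS sg => x; rewrite /w; congr (_ <= _)%E; congr EFin; ring.
move=> /(_ aew); apply: le_trans; rewrite -EFinD lee_fin.
suff : 0 <= (s1 - t1) * (mean (dens t1 t2) - 1) by lra.
have [t1c'|ct1] := ltP t1 c; first by rewrite (mE t1c') subrr mulr0.
by rewrite mulr_le0//; lra.
Qed.

Lemma Gfun_normalised : Gfun mu f X t2 = (mean (conj_at t1 t2) - t1)%:E.
Proof.
apply/eqP; rewrite eq_le; apply/andP; split.
  by apply: ereal_inf_lbound; exists t1 => //; rewrite normalised_Kfun.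
apply: le_ereal_inf_tmp => _ [s1 _ <-].
have := @normalised_Kfun_ge s1 t2 (ltW t2_lt0).
by rewrite subrr mulr0 addr0.
Qed.

End normalised_point.

(** * The dual function and its derivative *)

Local Notation mass t1 t2 := (mean (dens t1 t2)).
Local Notation tilted_mean t1 t2 := (mean (fun x => X x * dens t1 t2 x)).

Lemma Gfun_fin (t2 : R) : t2 < 0 -> Gfun mu f X t2 = (fine (Gfun mu f X t2))%:E.
Proof.
by move=> t20; have [t1 Hn] := normalised_exists (ltW t20); rewrite (Gfun_normalised t20 Hn).
Qed.

(** The finite values of the dual function; it is kept abstract so that its
    definition as an infimum is never unfolded. *)
Context (G : R -> R) (GfunG : forall t : R, t < 0 -> Gfun mu f X t = (G t)%:E).

Lemma GfunE (t1 t2 : R) : t2 < 0 -> normalised t1 t2 ->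
  G t2 = mean (conj_at t1 t2) - t1.
Proof. by move=> t20 Hn; apply: EFin_inj; rewrite -GfunG// (Gfun_normalised t20 Hn). Qed.

Lemma G_le_Kfun (t1 t2 : R) : t2 < 0 -> ((G t2)%:E <= Kfun mu f X t1 t2 - t1%:E)%E.
Proof. by move=> t20; rewrite -GfunG//; apply: ereal_inf_lbound; exists t1. Qed.

Lemma G_subgradient (t1 t2 s : R) : t2 < 0 -> s < 0 -> normalised t1 t2 ->
  G t2 + tilted_mean t1 t2 * (s - t2) <= G s.
Proof.
move=> t20 s0 Hn; have [s1 Hs] := normalised_exists (ltW s0).
have := normalised_Kfun_ge t20 Hn s1 (ltW s0).
by rewrite (normalised_Kfun s0 Hs) -EFinB lee_fin (GfunE s0 Hs) (GfunE t20 Hn).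
Qed.

Lemma tilted_mean_ge0 (t1 t2 : R) : 0 <= tilted_mean t1 t2.
Proof.
apply: ae_ge0_mean; first by apply: measurable_funM => //; exact: measurable_dens.
by apply: filterS X_ge0 => x x0; rewrite mulr_ge0// dens_ge0.
Qed.

Lemma fconj_derive1_1 : fconj f (df 1) = (df 1)%:E.
Proof.
by rewrite fconjE ?derive1_lt_slope// psi_derive1_1 fext_gt0//= f1 mul1r subr0.
Qed.

Lemma Kfun_derive1_1 : Kfun mu f X (df 1) 0 = (df 1)%:E.
Proof.
rewrite -[in RHS](mean_cst mu (df 1)); apply: integral_or_pinfty_ae.
- exact: measurable_fconj_tau.
- exact: L1_cst.
- by apply: nearW => x; rewrite mul0r addr0 fconj_derive1_1.
Qed.

(** The subgradient inequality at s1 = f'(1), s2 = 0, where K(s1, 0) - s1 vanishes. *)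
Lemma G_le_tilted_mean (t1 t2 : R) : t2 < 0 -> normalised t1 t2 ->
  G t2 <= tilted_mean t1 t2 * t2.
Proof.
move=> t20 Hn; have := normalised_Kfun_ge t20 Hn (df 1) (lexx 0).
by rewrite Kfun_derive1_1 subee// lee_fin -(GfunE t20 Hn); lra.
Qed.

Lemma G_ge (t2 : R) : t2 < 0 -> t2 * mean X <= G t2.
Proof.
move=> t20; have [t1 Hn] := normalised_exists (ltW t20).
have := @Kfun_ge t1 t2 _ (L1_tau t1 t2) _.
rewrite mean_tau (normalised_Kfun t20 Hn) (GfunE t20 Hn) lee_fin.
have H : {ae mu, forall x, ((t1 + t2 * X x)%:E <= fconj f (t1 + t2 * X x))%E}.
  by apply: nearW => x; exact: fconj_ge_id.
move=> /(_ H); lra.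
Qed.

Lemma tilted_mean_le (t1 t2 : R) : t2 < 0 -> normalised t1 t2 -> tilted_mean t1 t2 <= mean X.
Proof.
by move=> t20 Hn; have := G_le_tilted_mean t20 Hn; have := G_ge t20; nra.
Qed.

(** The subgradients lie between 0 and the mean of X. *)
Lemma G_lipschitz (s t : R) : s <= t -> t < 0 -> G s <= G t <= G s + mean X * (t - s).
Proof.
move=> st t0; have s0 := le_lt_trans st t0.
have [s1 Hs] := normalised_exists (ltW s0).
have [t1 Ht] := normalised_exists (ltW t0).
have := G_subgradient s0 t0 Hs; have := G_subgradient t0 s0 Ht.
have ts0 : 0 <= t - s by rewrite subr_ge0.
have := mulr_ge0 (tilted_mean_ge0 s1 s) ts0; have := ler_wpM2r ts0 (tilted_mean_le t0 Ht).
set a := tilted_mean s1 s; set b := tilted_mean t1 t; set m := mean X => h1 h2 h3 h4.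
by apply/andP; split; lra.
Qed.

Lemma G_continuous (t : R) : t < 0 -> G s @[s --> t] --> G t.
Proof.
move=> t0; apply/cvgrPdist_le => e e0.
have M0 : 0 < mean X := mean_X_gt0.
near=> s.
have s0 : s < 0 by near: s; exact: lt_nbhsl.
have : `|t - s| <= e / mean X.
  by near: s; apply: cvgr_dist_le; [exact: cvg_id|rewrite divr_gt0].
rewrite ler_pdivlMr// => H; apply: le_trans H.
have [st|ts] := leP s t.
  have /andP[h1 h2] := G_lipschitz st t0.
  rewrite (ger0_norm (_ : 0 <= t - s)) ?subr_ge0// ger0_norm ?subr_ge0//.
  by move: h2; set m := mean X; lra.
have /andP[h1 h2] := G_lipschitz (ltW ts) s0.
have -> : `|t - s| = s - t by rewrite distrC gtr0_norm ?subr_gt0.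
have -> : `|G t - G s| = G s - G t by rewrite distrC ger0_norm ?subr_ge0.
by move: h2; set m := mean X; lra.
Unshelve. all: by end_near. Qed.

Lemma dens_le (s1 s2 t1 t2 : R) (x : T) : s1 + s2 * X x <= t1 + t2 * X x ->
  t1 + t2 * X x < c -> dens s1 s2 x <= dens t1 t2 x.
Proof.
by move=> le tc; rewrite !densE// ?psi_le// (le_lt_trans le).
Qed.

Lemma dens_cvg (s1 s2 : nat -> R) (t1 t2 : R) (x : T) : t1 + t2 * X x < c ->
  s1 n @[n --> \oo] --> t1 -> s2 n @[n --> \oo] --> t2 ->
  dens (s1 n) (s2 n) x @[n --> \oo] --> dens t1 t2 x.
Proof.
move=> xc c1 c2; rewrite densE//.
have cv : s1 n + s2 n * X x @[n --> \oo] --> t1 + t2 * X x.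
  by apply: cvgD => //; apply: cvgM => //; exact: cvg_cst.
have := cvg_comp _ _ cv (psi_continuous xc).
apply: cvg_trans; apply: near_eq_cvg; near=> n.
by rewrite densE//; near: n; apply: (cvgr_lt _ cv).
Unshelve. all: by end_near. Qed.

Section subgradient.
Context (t1 t2 : R) (t2_lt0 : t2 < 0) (Hn : normalised t1 t2).

(** The pair (t1, t2 - h) is a competitor in the infimum that defines G (t2 - h). *)
Lemma G_left_le (h : R) : 0 < h ->
  G (t2 - h) <= G t2 - h * mean (fun x => X x * dens t1 (t2 - h) x).
Proof.
move=> h0; have [t1c tc LD m1 mE] := Hn.
have Lc := normalised_L1_conj t2_lt0 Hn; have LX := normalised_L1_XD t2_lt0 Hn.
have t2h : t2 - h < 0 by move: t2_lt0; lra.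
have tle : {ae mu, forall x, t1 + (t2 - h) * X x <= t1 + t2 * X x}.
  apply: filterS X_ge0 => x x0; have := mulr_ge0 (ltW h0) x0; lra.
have tch : {ae mu, forall x, t1 + (t2 - h) * X x < c}.
  by apply: filterS2 tc tle => x /[swap]; exact: le_lt_trans.
have LXh : L1 (fun x => X x * dens t1 (t2 - h) x).
  apply: (@ae_le_L1 _ _ _ mu _ (fun x => X x * dens t1 t2 x)) => //.
    by apply: measurable_funM => //; exact: measurable_dens.
  apply: filterS3 X_ge0 tc tle => x x0 xc xle.
  by rewrite ger0_norm ?mulr_ge0 ?dens_ge0// ler_wpM2l// dens_le.
have Lch : L1 (conj_at t1 (t2 - h)).
  apply: (@ae_sandwich_L1 _ _ _ mu (tau t1 (t2 - h)) _ (conj_at t1 t2)) => //.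
  - exact: (measurableT_comp _ (measurable_fconj_tau t1 (t2 - h))).
  - exact: L1_tau.
  - apply: filterS tch => x xc; have := fconj_ge_id (t1 + (t2 - h) * X x).
    by rewrite fconjE.
  - by apply: filterS2 tc tle => x xc xle; exact: fconj_le.
have := G_le_Kfun t1 t2h; rewrite (Kfun_mean tch Lch) -EFinB lee_fin.
rewrite (GfunE t2_lt0 Hn).
have : mean (fun x => conj_at t1 (t2 - h) x + h * (X x * dens t1 (t2 - h) x))
    <= mean (conj_at t1 t2).
  apply: ae_le_mean => //; first by apply: L1_D => //; exact: L1_Z.
  have sg := @conj_subgradient_ae t1 (t2 - h) t1 t2 tch.
  by apply: filterS2 tc sg => x xc; rewrite (fconjE xc) lee_fin /=; lra.
rewrite mean_D//; last exact: L1_Z.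
rewrite mean_Z//; lra.
Qed.

Lemma tilted_mean_le_subgradient (v : R) : (forall s, s < 0 -> G t2 + v * (s - t2) <= G s) ->
  tilted_mean t1 t2 <= v.
Proof.
move=> H; have [t1c tc LD m1 mE] := Hn; have LX := normalised_L1_XD t2_lt0 Hn.
pose h (n : nat) : R := 1 / n.+1%:R.
have h0 n : 0 < h n by rewrite divr_gt0.
rewrite -lerN2 -[leRHS]mulN1r -mean_Z//.
apply: (@dominated_ge _ _ _ mu (fun n x => -1 * (X x * dens t1 (t2 - h n) x)) _
  (fun x => X x * dens t1 t2 x)) => //.
- move=> n; apply: measurable_funM => //; apply: measurable_funM => //.
  exact: measurable_dens.
- exact: (L1_measurable (L1_Z (-1) LX)).
- apply: filterS tc => x xc; apply: cvgM; first exact: cvg_cst.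
  apply: cvgM; first exact: cvg_cst.
  apply: (@dens_cvg (fun=> t1) (fun n => t2 - h n)) => //; first exact: cvg_cst.
  have := @cvg_harmonicZ t2 (-1); apply: cvg_trans; apply: near_eq_cvg; near=> n.
  by rewrite /h mulN1r div1r.
- apply: filterS2 X_ge0 tc => x x0 xc n.
  rewrite mulN1r normrN ger0_norm ?mulr_ge0 ?dens_ge0// ler_wpM2l// dens_le//.
  by have := mulr_ge0 (ltW (h0 n)) x0; lra.
- move=> n; have t2h : t2 - h n < 0 by have := h0 n; move: t2_lt0; lra.
  have := G_left_le (h0 n); have := H _ t2h.
  set m := mean (fun x => X x * _) => le1 le2.
  have : m <= v.
    by rewrite -(ler_pM2l (h0 n)); lra.
  rewrite (_ : mean (fun x => -1 * _) = - m) ?lerN2//.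
  rewrite /m mean_Z ?mulN1r//.
  apply: (@ae_le_L1 _ _ _ mu _ (fun x => X x * dens t1 t2 x)) => //.
    by apply: measurable_funM => //; exact: measurable_dens.
  apply: filterS2 X_ge0 tc => x x0 xc.
  rewrite ger0_norm ?mulr_ge0 ?dens_ge0// ler_wpM2l// dens_le//.
  by have := mulr_ge0 (ltW (h0 n)) x0; lra.
Unshelve. all: by end_near. Qed.

(** For t1 = c the pair (t1, t2 + h) may have infinite K.  Lowering t1 by u h at the
    same time keeps the competitor admissible for every u > 0. *)
Lemma G_right_le (u h : R) : 0 < u -> 0 < h -> t2 + h < 0 ->
  G (t2 + h) <= G t2 + h * (mean (fun x => dens (t1 - u * h) (t2 + h) x * (X x - u)) + u).
Proof.
move=> u0 h0 t2h; have [t1c tc LD m1 mE] := Hn.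
have Lc := normalised_L1_conj t2_lt0 Hn.
have uh0 : 0 < u * h by rewrite mulr_gt0.
have s1c : t1 - u * h < c by lra.
have tch : {ae mu, forall x, t1 - u * h + (t2 + h) * X x < c}.
  by apply: filterS (tau_lt (ltW t2h) s1c) => x [].
have Lch := L1_conj_at (ltW t2h) s1c.
have LDh := L1_dens (ltW t2h) s1c.
have LXh : L1 (fun x => dens (t1 - u * h) (t2 + h) x * (X x - u)).
  apply: (@ae_le_L1 _ _ _ mu _ (fun x => psi (t1 - u * h) * (X x + u))).
  - apply: measurable_funM; first exact: measurable_dens.
    exact: measurable_funB.
  - by apply: L1_Z; apply: L1_D; [exact: L1_X|exact: L1_cst].
  - apply: filterS2 X_ge0 (tau_lt (ltW t2h) s1c) => x x0 [xt xc].
    rewrite normrM ger0_norm ?dens_ge0//; apply: ler_pM => //.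
    + exact: dens_ge0.
    + by rewrite densE// psi_le.
    + by rewrite ler_norml; lra.
have := G_le_Kfun (t1 - u * h) t2h; rewrite (Kfun_mean tch Lch) -EFinB lee_fin.
rewrite (GfunE t2_lt0 Hn).
have : mean (fun x => conj_at (t1 - u * h) (t2 + h) x +
      (- h) * (dens (t1 - u * h) (t2 + h) x * (X x - u))) <= mean (conj_at t1 t2).
  apply: ae_le_mean => //; first by apply: L1_D => //; exact: L1_Z.
  have sg := @conj_subgradient_ae (t1 - u * h) (t2 + h) t1 t2 tch.
  by apply: filterS2 tc sg => x xc; rewrite (fconjE xc) lee_fin /=; lra.
rewrite mean_D//; last exact: L1_Z.
rewrite mean_Z//; lra.
Qed.

(** The direction (- u, 1) costs u (1 - mass), which disappears as u tends to 0.
    Domination holds because the argument increases only where X > u, and there it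
    stays below t1 + t2 u < c. *)
Lemma tilted_mean_ge_subgradient (v : R) : (forall s, s < 0 -> G t2 + v * (s - t2) <= G s) ->
  v <= tilted_mean t1 t2.
Proof.
move=> H; have [t1c tc LD m1 mE] := Hn; have LX := normalised_L1_XD t2_lt0 Hn.
suff main (u : R) : 0 < u -> v - u <= tilted_mean t1 t2 - u * mass t1 t2.
  apply/ler_addgt0Pr => e e0; have := main e e0.
  have : 0 <= e * mass t1 t2.
    apply: mulr_ge0; first exact: ltW.
    by apply: Rintegral_ge0 => x _; exact: dens_ge0.
  lra.
move=> u0.
have [h0 [h0_gt0 t2h0]] : exists h : R, 0 < h /\ t2 + h < 0.
  by exists (- t2 / 2); split; move: t2_lt0; lra.
have hn (n : nat) : 0 < h0 / n.+1%:R <= h0.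
  by have /andP[_ ->] := @divn_le h0 n (ltW h0_gt0); rewrite divr_gt0.
have -> : tilted_mean t1 t2 - u * mass t1 t2 = mean (fun x => dens t1 t2 x * (X x - u)).
  rewrite -mean_Z// -mean_B//; last exact: L1_Z.
  by congr (fine _); apply: eq_integral => x _; congr EFin; ring.
apply: (@dominated_ge _ _ _ mu
  (fun n x => dens (t1 + (- (u * h0)) / n.+1%:R) (t2 + h0 / n.+1%:R) x * (X x - u)) _
  (fun x => u * dens t1 t2 x + psi (t1 + t2 * u) * X x)).
- move=> n; apply: measurable_funM; first exact: measurable_dens.
  exact: measurable_funB.
- apply: measurable_funM; first exact: measurable_dens.
  exact: measurable_funB.
- apply: filterS tc => x xc; apply: cvgM; last exact: cvg_cst.
  apply: (@dens_cvg (fun n => t1 + (- (u * h0)) / n.+1%:R) (fun n => t2 + h0 / n.+1%:R)) => //;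
    exact: cvg_harmonicZ.
- by apply: L1_comb => //; exact: L1_X.
- apply: filterS2 X_ge0 tc => x x0 xc n.
  rewrite mulNr -mulrA; have := hn n; set q := h0 / _ => /andP[q0 qh].
  have p1 : 0 <= u * dens t1 t2 x by rewrite mulr_ge0 ?dens_ge0 ?ltW.
  have p2 : 0 <= psi (t1 + t2 * u) * X x by rewrite mulr_ge0 ?psi_ge0.
  have t2q : t2 + q < 0 by lra.
  have cu : t1 + t2 * u < c.
    have : t2 * u < 0 by rewrite nmulr_rlt0. 
    by lra.
  rewrite normrM ger0_norm ?dens_ge0//.
  have [Xu|uX] := leP (X x) u.
    rewrite ler0_norm ?subr_le0// opprB.
    have d1 : dens (t1 - u * q) (t2 + q) x <= dens t1 t2 x.
      apply: dens_le => //; nra.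
    have := dens_ge0 (t1 - u * q) (t2 + q) x.
    move: d1 p1 p2; set a := dens _ _ x; set b := dens _ _ x; set w := psi _ * _.
    nra.
  rewrite ger0_norm; last by rewrite subr_ge0 ltW.
  have lt1 : t1 - u * q + (t2 + q) * X x <= t1 + t2 * u by nra.
  have d1 : dens (t1 - u * q) (t2 + q) x <= psi (t1 + t2 * u).
    by rewrite densE ?psi_le// (le_lt_trans lt1).
  have H1 : dens (t1 - u * q) (t2 + q) x * (X x - u) <= psi (t1 + t2 * u) * X x.
    by apply: ler_pM => //; [exact: dens_ge0|rewrite subr_ge0 ltW|rewrite gerBl ltW].
  by move: H1 p1; set a := dens _ _ x * _; set b := u * _; set w := _ * X x; lra.
- move=> n; rewrite mulNr -mulrA; have := hn n; set q := h0 / _ => /andP[q0 qh].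
  have t2q : t2 + q < 0 by lra.
  have := G_right_le u0 q0 t2q; have := H _ t2q.
  set m := mean (fun x => dens (t1 - u * q) (t2 + q) x * (X x - u)) => le1 le2.
  by rewrite -(ler_pM2l q0); lra.
Qed.

Lemma subgradient_unique (v : R) : (forall s, s < 0 -> G t2 + v * (s - t2) <= G s) ->
  v = tilted_mean t1 t2.
Proof.
by move=> H; apply/eqP; rewrite eq_le tilted_mean_ge_subgradient//= tilted_mean_le_subgradient.
Qed.

End subgradient.

(** * Primal densities *)

Lemma density_L1 (p : T -> R) : density mu p -> L1 p /\ mean p = 1.
Proof.
case=> mp p0 pE; have Lp : L1 p.
  apply/integrableP; split; first exact/measurable_EFinP.
  under eq_integral do rewrite /= ger0_norm//.
  by rewrite pE ltry.
by split=> //; apply: EFin_inj; rewrite EFin_mean.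
Qed.

Lemma L1_density (p : T -> R) : L1 p -> (forall x, 0 <= p x) -> mean p = 1 -> density mu p.
Proof.
by move=> Lp p0 pE; split => //; [exact: L1_measurable Lp|rewrite -EFin_mean// pE].
Qed.

Lemma Xmean_L1 (p : T -> R) : density mu p -> (Xmean mu X p < +oo)%E ->
  L1 (fun x => X x * p x) /\ Xmean mu X p = (mean (fun x => X x * p x))%:E.
Proof.
case=> mp p0 _ fin.
have mXp : measurable_fun [set: T] (fun x => X x * p x) by exact: measurable_funM.
have LXp : L1 (fun x => X x * p x).
  apply/integrableP; split; first exact/measurable_EFinP.
  rewrite (ae_eq_integral (EFin \o (fun x => X x * p x)))//.
  - by apply: measurableT_comp => //; exact/measurable_EFinP.
  - exact/measurable_EFinP.
  - by apply: filterS X_ge0 => x x0 _ /=; rewrite ger0_norm ?mulr_ge0.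
by split => //; rewrite EFin_mean.
Qed.

Lemma measurable_fext_comp (p : T -> R) : measurable_fun [set: T] p ->
  measurable_fun [set: T] (fun x => fext f (p x)).
Proof. exact: measurableT_comp measurable_fext. Qed.

Lemma Hfun_fin (p : T -> R) (h : R) : density mu p -> (Hfun mu f p <= h%:E)%E ->
  [/\ L1 (fun x => fine (fext f (p x))),
      {ae mu, forall x, fext f (p x) = (fine (fext f (p x)))%:E} &
      mean (fun x => fine (fext f (p x))) <= h].
Proof.
move=> dp Hh; have [Lp mp] := density_L1 dp; case: dp => mp' p0 _.
have := @integral_or_pinfty_fin _ _ _ mu (fun x => fext f (p x))
  (fun x => df 1 * (p x - 1)) (measurable_fext_comp mp').
case=> //.
- by apply: L1_Z; apply: L1_B => //; exact: L1_cst.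
- by apply: nearW => x; exact: fext_ge_tangent.
- exact: le_lt_trans Hh (ltry _).
move=> L hE E; split => //; rewrite -lee_fin; apply: le_trans Hh.
by rewrite /Hfun E.
Qed.

(** The tangent of f at 1 integrates to 0 along densities. *)
Lemma Hfun_ge0 (p : T -> R) : density mu p -> (0 <= Hfun mu f p)%E.
Proof.
move=> dp; have [Lp mp] := density_L1 dp; case: dp => mp' p0 _.
have := @integral_or_pinfty_ge _ _ _ mu (fun x => fext f (p x))
  (fun x => df 1 * (p x - 1)) (measurable_fext_comp mp').
have Lp1 : L1 (fun x => p x - 1) by apply: L1_B => //; exact: L1_cst.
rewrite (mean_Z _ Lp1) (mean_B Lp (L1_cst mu 1)) mp mean_cst subrr mulr0.
apply; first exact: L1_Z.
by apply: nearW => x; exact: fext_ge_tangent.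
Qed.

Lemma weak_duality (p : T -> R) (b h t1 t2 : R) : density mu p -> Xmean mu X p = b%:E ->
  (Hfun mu f p <= h%:E)%E -> ((t2 * b - h)%:E <= Kfun mu f X t1 t2 - t1%:E)%E.
Proof.
move=> dp Xb Hh.
have [Lp mp] := density_L1 dp; have [Lr rE rh] := Hfun_fin dp Hh.
have [LXp XpE] : L1 (fun x => X x * p x) /\ Xmean mu X p = (mean (fun x => X x * p x))%:E.
  by apply: Xmean_L1 => //; rewrite Xb ltry.
have bE : b = mean (fun x => X x * p x) by apply: EFin_inj; rewrite -Xb.
rewrite leeBrDr//.
pose w x := (t1 * p x + t2 * (X x * p x)) - fine (fext f (p x)).
have Lw : L1 w by apply: L1_B => //; exact: L1_comb.
have := @Kfun_ge t1 t2 w Lw; rewrite mean_B//; last exact: L1_comb.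
rewrite mean_comb// mp -bE => H.
apply: le_trans (H _); first by rewrite -EFinD lee_fin; lra.
apply: filterS rE => x xE; apply: le_trans (fenchel_young (p x) _).
by rewrite xE -EFinB lee_fin /w; lra.
Qed.

Lemma weak_duality_G (p : T -> R) (b h t2 : R) : t2 < 0 -> density mu p ->
  Xmean mu X p = b%:E -> (Hfun mu f p <= h%:E)%E -> t2 * b - h <= G t2.
Proof.
move=> t20 dp Xb Hh; have [t1 Hn] := normalised_exists (ltW t20).
have := weak_duality t1 t2 dp Xb Hh.
by rewrite (normalised_Kfun t20 Hn) -EFinB lee_fin -(GfunE t20 Hn).
Qed.

Lemma weak_duality_F (b t2 : R) : t2 < 0 -> ((t2 * b - G t2)%:E <= Ffun mu f X b)%E.
Proof.
move=> t20; apply: le_ereal_inf_tmp => _ [p [dp Xb] <-].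
rewrite leNgt; apply/negP => Hlt.
have H0 := Hfun_ge0 dp.
have Hf : Hfun mu f p = (fine (Hfun mu f p))%:E.
  rewrite fineK// fin_real// (lt_le_trans _ H0) ?ltNyr//=.
  exact: lt_trans Hlt (ltry _).
have := @weak_duality_G p b (fine (Hfun mu f p)) t2 t20 dp Xb.
rewrite -Hf => /(_ (lexx _)).
by move: Hlt; rewrite Hf lte_fin; lra.
Qed.

Lemma fext_dens (t1 t2 : R) (x : T) : t1 + t2 * X x < c ->
  fext f (dens t1 t2 x) = (dens t1 t2 x * (t1 + t2 * X x) - conj_at t1 t2 x)%:E.
Proof.
move=> xc; rewrite densE// fconjE//= -[LHS](fineK (fext_psi_fin xc)).
by congr EFin; ring.
Qed.

(** Equality in Fenchel's inequality along the tilted density; the term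
    c (1 - mass) equals t1 (1 - mass) by normalisation. *)
Lemma mean_entropy (t1 t2 : R) : t2 < 0 -> normalised t1 t2 ->
  L1 (fun x => dens t1 t2 x * (t1 + t2 * X x) - conj_at t1 t2 x) /\
  mean (fun x => dens t1 t2 x * (t1 + t2 * X x) - conj_at t1 t2 x)
    + c * (1 - mass t1 t2) = t2 * tilted_mean t1 t2 - G t2.
Proof.
move=> t20 Hn; have [t1c tc LD m1 mE] := Hn.
have Lc := normalised_L1_conj t20 Hn; have LX := normalised_L1_XD t20 Hn.
have E : (fun x => dens t1 t2 x * (t1 + t2 * X x) - conj_at t1 t2 x) =
    (fun x => (t1 * dens t1 t2 x + t2 * (X x * dens t1 t2 x)) - conj_at t1 t2 x).
  by apply/funext => x; ring.
have Lcomb : L1 (fun x => t1 * dens t1 t2 x + t2 * (X x * dens t1 t2 x)) by exact: L1_comb.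
rewrite E; split; first exact: L1_B.
rewrite mean_B// mean_comb// (GfunE t20 Hn).
have [t1c'|ct1] := ltP t1 c; first by rewrite (mE t1c'); ring.
have -> : t1 = c by apply/eqP; rewrite eq_le t1c.
by ring.
Qed.

Lemma Hfun_dens (t1 t2 : R) : t2 < 0 -> normalised t1 t2 ->
  Hfun mu f (dens t1 t2) =
  (mean (fun x => dens t1 t2 x * (t1 + t2 * X x) - conj_at t1 t2 x))%:E.
Proof.
move=> t20 Hn; have [L _] := mean_entropy t20 Hn; have [_ tc _ _ _] := Hn.
apply: integral_or_pinfty_ae => //.
  by apply: measurable_fext_comp; exact: measurable_dens.
by apply: filterS tc => x; exact: fext_dens.
Qed.

(** The normalised indicator of {X < e}. *)
Lemma concentrated_density (e : R) : 0 < e ->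
  exists (q : T -> R) (a : R), [/\ L1 q, mean q = 1, 0 <= a /\ (forall x, q x = 0 \/ q x = a),
    L1 (fun x => X x * q x) & mean (fun x => X x * q x) <= e].
Proof.
move=> e0; pose A := [set x | X x < e].
have mA : measurable A := measurable_X_lt e.
have al0 : 0 < fine (mu A).
  by rewrite fine_gt0// X_lt_gt0//= (le_lt_trans (probability_le1 _ _))// ltry.
set al := fine (mu A) in al0.
pose ind : T -> R := \1_A.
have Lind : L1 ind by apply: integrable_indic => //; rewrite -ge0_fin_numE// fin_num_measure.
have mind : mean ind = al by rewrite /Rintegral integral_indic// setIT.
have Lq : L1 (fun x => al^-1 * ind x) by exact: L1_Z.
have mq : mean (fun x => al^-1 * ind x) = 1 by rewrite mean_Z// mind mulVf// gt_eqF.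
have q0 x : 0 <= al^-1 * ind x.
  by apply: mulr_ge0; [rewrite invr_ge0 ltW|rewrite /ind indicE].
have Xq : {ae mu, forall x, 0 <= X x * (al^-1 * ind x) <= e * (al^-1 * ind x)}.
  apply: filterS X_ge0 => x x0; rewrite mulr_ge0//= /ind indicE.
  case: (boolP (x \in A)) => [|_]; last by rewrite !mulr0.
  by rewrite inE/= mulr1 => /ltW xe; rewrite ler_wpM2r// invr_ge0 ltW.
have LXq : L1 (fun x => X x * (al^-1 * ind x)).
  apply: (@ae_le_L1 _ _ _ mu _ (fun x => e * (al^-1 * ind x))).
  - by apply: measurable_funM => //; exact: L1_measurable Lq.
  - exact: L1_Z.
  - by apply: filterS Xq => x /andP[? ?]; rewrite ger0_norm.
exists (fun x => al^-1 * ind x), al^-1; split => //.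
- split; first by rewrite invr_ge0 ltW.
  by move=> x; rewrite /ind indicE; case: (x \in A); [right|left]; rewrite ?mulr1 ?mulr0.
- rewrite -[leRHS]mulr1 -mq -mean_Z//; apply: ae_le_mean => //; first exact: L1_Z.
  by apply: filterS Xq => x /andP[].
Qed.

(** The missing mass is placed on {X < e}, at a cost of at most c per unit of mass. *)
Lemma completed_density (t1 t2 e : R) : t2 < 0 -> normalised t1 t2 -> 0 < e ->
  exists p : T -> R, [/\ density mu p,
    (Hfun mu f p <= (t2 * tilted_mean t1 t2 - G t2)%:E)%E &
    exists2 b : R, Xmean mu X p = b%:E & b <= tilted_mean t1 t2 + e].
Proof.
move=> t20 Hn e0; have [t1c tc LD m1 mE] := Hn.
have LX := normalised_L1_XD t20 Hn.
have [Lent entE] := mean_entropy t20 Hn.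
have [q [a [Lq mq [a0 qa] LXq mXq]]] := concentrated_density e0.
have q0 x : 0 <= q x by case: (qa x) => ->.
set r := 1 - mass t1 t2.
have r0 : 0 <= r by rewrite subr_ge0.
pose p x := dens t1 t2 x + r * q x.
have p0 x : 0 <= p x by rewrite addr_ge0 ?dens_ge0// mulr_ge0.
have Lrq : L1 (fun x => r * q x) by exact: L1_Z.
have Lp : L1 p by apply: L1_D.
have mp : mean p = 1 by rewrite (mean_D LD Lrq) (mean_Z r Lq) mq /r; ring.
have dp : density mu p by exact: L1_density.
exists p; split => //.
- rewrite -entE.
  have -> : mean (fun x => dens t1 t2 x * (t1 + t2 * X x) - conj_at t1 t2 x)
     + c * (1 - mass t1 t2) =
     mean (fun x => (dens t1 t2 x * (t1 + t2 * X x) - conj_at t1 t2 x) + c * (r * q x)).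
    by rewrite (mean_D Lent (L1_Z c Lrq)) (mean_Z c Lrq) (mean_Z r Lq) mq mulr1.
  apply: (@integral_or_pinfty_le _ _ _ mu _ (fun x => df 1 * (p x - 1))).
  + by apply: measurable_fext_comp; case: dp.
  + by apply: L1_Z; apply: L1_B => //; exact: L1_cst.
  + by apply: L1_D => //; exact: L1_Z.
  + by apply: nearW => x; exact: fext_ge_tangent.
  + apply: filterS tc => x xc; rewrite EFinD -fext_dens//.
    by apply: fext_add_le; [exact: dens_ge0|rewrite mulr_ge0].
- have XpE : (fun x => X x * p x) = (fun x => X x * dens t1 t2 x + r * (X x * q x)).
    by apply/funext => x; rewrite /p; ring.
  have LXp : L1 (fun x => X x * p x) by rewrite XpE; apply: L1_D => //; exact: L1_Z.
  exists (mean (fun x => X x * p x)); first by rewrite EFin_mean.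
  rewrite XpE (mean_D LX (L1_Z r LXq)) (mean_Z r LXq) lerD2l.
  apply: (@le_trans _ _ (r * e)); first by rewrite ler_wpM2l.
  apply: ler_piMl; first exact: ltW.
  by rewrite gerBl; apply: Rintegral_ge0 => x _; exact: dens_ge0.
Qed.

(** A small constant plus mass on {X < e}: it takes two positive values only, so its
    divergence is finite even if f(0) = +oo. *)
Lemma spread_density (e : R) : 0 < e -> exists (p : T -> R) (b h : R),
  [/\ density mu p, Xmean mu X p = b%:E, b <= e & (Hfun mu f p <= h%:E)%E].
Proof.
move=> e0; have e20 : 0 < e / 2 by rewrite divr_gt0.
have [q [a [Lq mq [a0 qa] LXq mXq]]] := concentrated_density e20.
have q0 x : 0 <= q x by case: (qa x) => ->.
have M0 := mean_X_gt0; set M := mean X in M0.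
(* The weight t of the constant makes t M + (1 - t) e / 2 at most e. *)
pose t := e / (2 * M + e).
have d0 : 0 < 2 * M + e by rewrite addr_gt0// mulr_gt0.
have t0 : 0 < t by rewrite divr_gt0.
have t1 : t < 1 by rewrite ltr_pdivrMr// mul1r ltrDr mulr_gt0.
have tE : t * (2 * M + e) = e by rewrite /t divfK// gt_eqF.
clearbody t.
pose p x := t * 1 + (1 - t) * q x.
have Lp : L1 p by apply: L1_comb => //; exact: L1_cst.
have p0 x : 0 < p x by rewrite ltr_pwDl ?mulr1// mulr_ge0// subr_ge0 ltW.
have mp : mean p = 1.
  by rewrite (mean_comb t (1 - t) (L1_cst mu 1) Lq) mq mean_cst; ring.
have dp : density mu p by apply: L1_density => // x; exact: ltW.
have XpE : (fun x => X x * p x) = (fun x => t * X x + (1 - t) * (X x * q x)).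
  by apply/funext => x; rewrite /p; ring.
have LXp : L1 (fun x => X x * p x) by rewrite XpE; apply: L1_comb => //; exact: L1_X.
exists p, (mean (fun x => X x * p x)), (`|f t| + `|f (t + (1 - t) * a)|); split => //.
- by rewrite EFin_mean.
- rewrite XpE (mean_comb t (1 - t) L1_X LXq) -/M.
  have t1' : 0 <= 1 - t by lra.
  have := ler_wpM2l t1' mXq; have := mulr_ge0 (ltW t0) (ltW e0).
  by move: tE; set z := mean (fun x => X x * q x); lra.
- rewrite -[X in X%:E](mean_cst mu).
  apply: (@integral_or_pinfty_le _ _ _ mu _ (fun x => df 1 * (p x - 1))).
  + by apply: measurable_fext_comp; case: dp.
  + by apply: L1_Z; apply: L1_B => //; exact: L1_cst.
  + exact: L1_cst.
  + by apply: nearW => x; exact: fext_ge_tangent.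
  + apply: nearW => x; rewrite fext_gt0// lee_fin /p mulr1.
    have := normr_ge0 (f t); have := normr_ge0 (f (t + (1 - t) * a)).
    case: (qa x) => ->.
      by rewrite mulr0 addr0; have := ler_norm (f t); lra.
    by have := ler_norm (f (t + (1 - t) * a)); lra.
Qed.

(** Mixing with the default density 1 raises the mean and does not raise H. *)
Lemma mix_density (p : T -> R) (b b' : R) : density mu p -> Xmean mu X p = b%:E ->
  b < b' -> b' < mean X -> (Ffun mu f X b' <= Hfun mu f p)%E.
Proof.
move=> dp Xb bb' bm.
have [Lp mp] := density_L1 dp; have p0 : forall x, 0 <= p x by case: dp.
have mp' : measurable_fun [set: T] p by case: dp.
have [LXp XpE] : L1 (fun x => X x * p x) /\ Xmean mu X p = (mean (fun x => X x * p x))%:E.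
  by apply: Xmean_L1 => //; rewrite Xb ltry.
have bE : mean (fun x => X x * p x) = b by apply: EFin_inj; rewrite -Xb.
(* The weight that moves the mean from b to b'. *)
pose t := (b' - b) / (mean X - b).
have d0 : 0 < mean X - b by lra.
have t01 : 0 < t < 1.
  apply/andP; split; first by rewrite divr_gt0// subr_gt0.
  by rewrite ltr_pdivrMr// mul1r; lra.
have /andP[t0 t1] := t01.
pose q x := (1 - t) * p x + t * 1.
have Lq : L1 q by apply: L1_comb => //; exact: L1_cst.
have q0 x : 0 <= q x by rewrite addr_ge0// mulr_ge0 ?p0//; lra.
have mq : mean q = 1.
  by rewrite mean_comb ?mean_cst ?mp//; [ring|exact: L1_cst].
have dq : density mu q by exact: L1_density.
have XqE : (fun x => X x * q x) = (fun x => (1 - t) * (X x * p x) + t * X x).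
  by apply/funext => x; rewrite /q; ring.
have Xq : Xmean mu X q = b'%:E.
  rewrite /Xmean -EFin_mean; rewrite XqE; last by apply: L1_comb => //; exact: L1_X.
  rewrite mean_comb//; last exact: L1_X.
  rewrite bE; congr EFin.
  have : t * (mean X - b) = b' - b by rewrite /t mulfVK ?gt_eqF.
  by move: (mean X) => M; lra.
apply: (@le_trans _ _ (Hfun mu f q)); first by apply: ereal_inf_lbound; exists q.
have H0 := Hfun_ge0 dp.
have [Hf|Hf] := ltP (Hfun mu f p) +oo%E; last first.
  by move: Hf; rewrite leye_eq => /eqP ->; rewrite leey.
have HE : Hfun mu f p = (fine (Hfun mu f p))%:E.
  by rewrite fineK// fin_real// (lt_le_trans _ H0) ?ltNyr.
have [Lr rE rh] : [/\ L1 (fun x => fine (fext f (p x))),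
      {ae mu, forall x, fext f (p x) = (fine (fext f (p x)))%:E} &
      mean (fun x => fine (fext f (p x))) <= fine (Hfun mu f p)].
  by apply: Hfun_fin => //; rewrite -HE.
rewrite HE.
apply: (@le_trans _ _ (mean (fun x => (1 - t) * fine (fext f (p x))))%:E).
  apply: (@integral_or_pinfty_le _ _ _ mu _ (fun x => df 1 * (q x - 1))).
  - by apply: measurable_fext_comp; case: dq.
  - by apply: L1_Z; apply: L1_B => //; exact: L1_cst.
  - exact: L1_Z.
  - by apply: nearW => x; exact: fext_ge_tangent.
  - apply: filterS rE => x xE; rewrite EFinM -xE /q mulr1.
    exact: fext_mix_le.
rewrite mean_Z// lee_fin.
have h0 : 0 <= fine (Hfun mu f p) by rewrite fine_ge0.
apply: (@le_trans _ _ ((1 - t) * fine (Hfun mu f p))).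
  by rewrite ler_wpM2l//; lra.
by rewrite ler_piMl//; lra.
Qed.

(** * Duality *)

(** F is nonincreasing up to the mean of X by mixing, so its limit at 0 is a supremum. *)
Lemma kmaxE : kmax mu f X 0 = ereal_sup [set Ffun mu f X b | b in `]0, mean X[].
Proof.
apply: cvg_lim => //.
apply: (@nonincreasing_at_right_cvge R _ 0 (BLeft (mean X))).
  by rewrite bnd_simp mean_X_gt0.
move=> b b'; rewrite !in_itv/= => /andP[b0 bM] /andP[b0' bM'].
rewrite le_eqVlt => /predU1P[->//|bb'].
apply: le_ereal_inf_tmp => _ [p [dp Xb] <-].
exact: (mix_density dp Xb).
Qed.

Lemma kmax_ge (t2 : R) : t2 < 0 -> forall b, 0 < b < mean X ->
  ((t2 * b - G t2)%:E <= kmax mu f X 0)%E.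
Proof.
move=> t20 b b0; apply: le_trans (weak_duality_F b t20) _.
by rewrite kmaxE; apply: ereal_sup_ubound; exists b => //=; rewrite in_itv.
Qed.

(** If G >= - k everywhere, completed densities have H <= k and, as t2 tends to -oo,
    means of order k / |t2|; then F <= k at all small means. *)
Lemma kmax_dual (k : R) : (k%:E < kmax mu f X 0)%E -> exists2 t : R, t < 0 & G t < - k.
Proof.
rewrite kmaxE => /ereal_sup_gt[_ [b /=] + <-]; rewrite in_itv/= => /andP[b0 bM] kF.
apply: contrapT => nex.
have Gk (t : R) : t < 0 -> - k <= G t.
  by move=> t0; rewrite leNgt; apply/negP => Gt; apply: nex; exists t.
have bad (t t1 : R) : t < 0 -> normalised t1 t -> 0 <= k /\ tilted_mean t1 t * - t <= k /\
    b <= tilted_mean t1 t + b / 4.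
  move=> t0 Hn; have b40 : 0 < b / 4 by rewrite divr_gt0.
  have [p [dp Hp [b' Xp b'le]]] := completed_density t0 Hn b40.
  have H0 := le_trans (Hfun_ge0 dp) Hp; rewrite lee_fin in H0.
  have s0 := tilted_mean_ge0 t1 t; have Gt := Gk _ t0.
  move: H0 b'le s0 Hp; set s := tilted_mean t1 t => H0 b'le s0 Hp.
  have ts : t * s <= 0 by apply: mulr_le0_ge0 => //; exact: ltW.
  split; first by lra.
  split; first by lra.
  rewrite leNgt; apply/negP => lt.
  have b'b : b' < b by lra.
  have := le_trans (mix_density dp Xp b'b bM) Hp; rewrite leNgt => /negP; apply.
  by apply: le_lt_trans kF; rewrite lee_fin; lra.
have [u Hu] := normalised_exists (lerN10 R).
have [k0 _] := bad _ _ (ltrN10 R) Hu.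
(* For this multiplier the mean of the tilted density is below b / 4. *)
pose t := - (4 * (k + 1) / b).
have t0 : t < 0 by rewrite /t oppr_lt0 divr_gt0// mulr_gt0//; lra.
have tb : - t * b = 4 * (k + 1) by rewrite /t opprK divfK// gt_eqF.
clearbody t.
have [t1 Hn] := normalised_exists (ltW t0).
have [_ []] := bad _ _ t0 Hn; set s := tilted_mean t1 t => h1 h2.
have : 0 <= (s - 3 / 4 * b) * - t by rewrite mulr_ge0//; lra.
lra.
Qed.

(** The line v s - k supports G at t: equivalently, (k + G s) / s is maximal at s = t
    among s < 0, with value v. *)
Definition attains (k v t : R) : Prop :=
  [/\ t < 0, G t = v * t - k & forall s, s < 0 -> v * s - k <= G s].

(** Near 0 the bound G s >= s mean X makes the quotient nonpositive.  Far away, weak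
    duality with a density of small mean and finite divergence keeps it below its
    value at s0.  In between it is continuous on a compact interval. *)
Lemma attains_exists (k : R) : 0 < k -> (exists2 t : R, t < 0 & G t < - k) ->
  exists v t : R, attains k v t.
Proof.
move=> k0 [s0 s00 Gs0].
pose obj (t : R) := (k + G t) / t.
have v00 : 0 < obj s0 by rewrite /obj ltr_ndivlMr// mul0r; lra.
have v0E : obj s0 * s0 = k + G s0 by rewrite /obj divfK// lt_eqF.
set v0 := obj s0 in v00 v0E.
have v020 : 0 < v0 / 2 by rewrite divr_gt0.
have [p [b [h [dp Xb bv Hp]]]] := spread_density v020.
have M0 := mean_X_gt0.
pose B := 2 * `|h - k| / v0.
have BE : B * v0 = 2 * `|h - k| by rewrite /B divfK// gt_eqF.
have B0 : 0 <= B by apply: divr_ge0; [exact: mulr_ge0|exact: ltW].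
have far (t : R) : t <= - B -> t < 0 -> v0 * t <= k + G t.
  move=> tB t0; have := weak_duality_G t0 dp Xb Hp.
  have := ler_norm (h - k).
  have : 0 <= (- B - t) * (v0 / 2) by rewrite mulr_ge0//; lra.
  have : 0 <= - t * (v0 / 2 - b) by rewrite mulr_ge0//; lra.
  lra.
have near0 (t : R) : t < 0 -> - (k / mean X) <= t -> v0 * t <= k + G t.
  move=> t0; rewrite lerNl ler_pdivlMr// => tk.
  have := G_ge t0; have : v0 * t < 0 by rewrite pmulr_rlt0.
  lra.
pose lo := Num.min (- B) s0; pose hi := Num.max (- (k / mean X)) s0.
have hi0 : hi < 0 by rewrite /hi gt_max s00 oppr_lt0 divr_gt0.
have losh : lo <= s0 <= hi by rewrite /lo /hi ge_min le_max lexx !orbT.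
have lohi : lo <= hi by case/andP: losh; exact: le_trans.
have cobj : {within `[lo, hi], continuous obj}.
  apply: continuous_in_subspaceT => t; rewrite inE/= in_itv/= => /andP[_ thi].
  have t0 := le_lt_trans thi hi0.
  apply: cvgM; first by apply: cvgD; [exact: cvg_cst|exact: G_continuous].
  by apply: cvgV; [rewrite lt_eqF|exact: cvg_id].
have [t + tmax] := EVT_max lohi cobj.
rewrite in_itv/= => /andP[_ thi]; have t0 := le_lt_trans thi hi0.
have s0t : v0 <= obj t by apply: tmax; rewrite in_itv.
exists (obj t), t; split => //; first by rewrite /obj divfK ?lt_eqF//; ring.
move=> s sl; suff : v0 * s <= k + G s \/ obj s <= obj t.
  case.
    have : obj t * s <= v0 * s by rewrite ler_wnM2r// ltW.
    by lra.
  move=> H; have : obj t * s <= obj s * s by rewrite ler_wnM2r// ltW.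
  by rewrite {2}/obj divfK ?lt_eqF//; lra.
have [slo|los] := leP s lo.
  by left; apply: far => //; apply: le_trans slo _; rewrite /lo ge_min lexx.
have [shi|his] := leP s hi.
  by right; apply: tmax; rewrite in_itv/= shi ltW.
by left; apply: near0 => //; apply: ltW; apply: le_lt_trans his; rewrite /hi le_max lexx.
Qed.

(** The value of the dual problem is the mean of X under the tilted density, since
    the supporting line is a subgradient. *)
Lemma attains_tilted_mean (k v t1 t2 : R) : attains k v t2 -> normalised t1 t2 ->
  v = tilted_mean t1 t2.
Proof.
case=> t20 GE H Hn; apply: (subgradient_unique t20 Hn) => s s0.
by have := H s s0; rewrite GE; lra.
Qed.

(** Supporting lines at two points with intercepts - k and - k' give the weak order;
    if the points agree, the lines agree by uniqueness of the subgradient. *)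
Lemma attains_lt (k k' v v' t t' : R) : attains k v t -> attains k' v' t' -> k < k' -> t' < t.
Proof.
move=> At At' kk'; have [t0 GE H] := At; have [t0' GE' H'] := At'.
have h1 := H _ t0'; have h2 := H' _ t0.
have le : t' <= t by rewrite GE' in h1; rewrite GE in h2; nra.
rewrite lt_neqAle le andbT; apply/eqP => tt'.
have [t1 Hn] := normalised_exists (ltW t0).
have E := attains_tilted_mean At Hn; rewrite -tt' in Hn E.
have E' := attains_tilted_mean At' Hn.
by move: GE GE'; rewrite tt' E' -E; lra.
Qed.

Lemma dual_objectiveE (k t1 t2 K : R) : Kfun mu f X t1 t2 = K%:E ->
  dual_objective mu f X k t1 t2 = ((k + K - t1) / t2)%:E.
Proof. by move=> KE; rewrite /dual_objective KE. Qed.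

Lemma Kfun_gtNy (t1 t2 : R) : (-oo < Kfun mu f X t1 t2)%E.
Proof.
have H : {ae mu, forall x, ((t1 + t2 * X x)%:E <= fconj f (t1 + t2 * X x))%E}.
  by apply: nearW => x; exact: fconj_ge_id.
by apply: lt_le_trans (Kfun_ge (L1_tau t1 t2) H); rewrite ltNyr.
Qed.

(** The factor 1 / t2 is negative. *)
Lemma dual_objective_pinfty (k t1 t2 : R) : t2 < 0 -> Kfun mu f X t1 t2 = +oo%E ->
  dual_objective mu f X k t1 t2 = -oo%E.
Proof.
move=> t20 KE; rewrite /dual_objective KE addey// addye//.
by rewrite mulyr ltr0_sg ?invr_lt0// EFinN mulN1e.
Qed.

Lemma attains_objective (k v t1 t2 : R) : attains k v t2 -> normalised t1 t2 ->
  dual_objective mu f X k t1 t2 = v%:E.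
Proof.
case=> t20 GE _ Hn; rewrite (dual_objectiveE _ (normalised_Kfun t20 Hn)).
congr EFin; move: GE; rewrite (GfunE t20 Hn) => GE.
rewrite (_ : k + _ - t1 = v * t2); last by lra.
by rewrite mulfK// lt_eqF.
Qed.

Lemma objective_le (k v t2 s1 s2 : R) : attains k v t2 -> s2 < 0 ->
  (dual_objective mu f X k s1 s2 <= v%:E)%E.
Proof.
case=> t20 _ H s20; have := G_le_Kfun s1 s20; have := H _ s20.
case KE : (Kfun mu f X s1 s2) => [K| |].
- rewrite (dual_objectiveE _ KE) -EFinB !lee_fin ler_ndivrMr//; lra.
- by rewrite dual_objective_pinfty// leNye.
- by have := Kfun_gtNy s1 s2; rewrite KE.
Qed.

Lemma attains_maximiser (k v t1 t2 : R) : attains k v t2 -> normalised t1 t2 ->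
  dual_maximiser mu f X k t1 t2.
Proof.
move=> At Hn; split; first by case: At.
by move=> s1 s2 s20; rewrite (attains_objective At Hn); exact: objective_le At s20.
Qed.

(** Two maximisers lie on a common affine piece of K(t1, t2) - t1.  Hence the
    subgradient inequality of f^* integrates to an equality, so it is an equality
    almost everywhere, and conjugate points are unique. *)
Lemma localiser_unique (k v t1 t2 s1 s2 : R) : attains k v t2 -> normalised t1 t2 ->
  dual_maximiser mu f X k s1 s2 ->
  (Kfun mu f X s1 s2 < +oo)%E /\
  ({ae mu, forall x, s1 + s2 * X x < c} ->
    {ae mu, forall x, dens t1 t2 x = dens s1 s2 x}).
Proof.
move=> At Hn [s20 smax]; have [t20 GE H] := At.
have := smax t1 t2 t20; rewrite (attains_objective At Hn) => le1.
case KE : (Kfun mu f X s1 s2) => [K| |]; last 2 first.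
- by move: le1; rewrite dual_objective_pinfty.
- by have := Kfun_gtNy s1 s2; rewrite KE.
split; first by rewrite ltry.
move=> sc; have [t1c tc LD m1 mE] := Hn.
have s1c : s1 <= c.
  by rewrite leNgt; apply/negP => cs; move: KE; rewrite Kfun_pinfty// ltW.
have := objective_le s1 At s20; move: le1.
rewrite (dual_objectiveE _ KE) !lee_fin => le1 le2.
have vE : k + K - s1 = v * s2.
  have -> : v = (k + K - s1) / s2 by apply/eqP; rewrite eq_le le1 le2.
  by rewrite divfK// lt_eqF.
have Lc := normalised_L1_conj t20 Hn; have LX := normalised_L1_XD t20 Hn.
have Kfin : (Kfun mu f X s1 s2 < +oo)%E by rewrite KE ltry.
have [Ls sE] := Kfun_fin Kfin; rewrite KE => -[KE'].
pose w x := conj_at s1 s2 x - (conj_at t1 t2 x +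
   ((s1 - t1) * dens t1 t2 x + (s2 - t2) * (X x * dens t1 t2 x))).
have Lcomb := L1_comb (s1 - t1) (s2 - t2) LD LX.
have Lw : L1 w by apply: L1_B => //; exact: L1_D.
have w0 : {ae mu, forall x, 0 <= w x}.
  have sg := @conj_subgradient_ae t1 t2 s1 s2 tc.
  by apply: filterS2 sg sE => x + xE; rewrite xE lee_fin /w; lra.
have mw : mean w = (s1 - t1) * (1 - mass t1 t2).
  rewrite (mean_B Ls (L1_D Lc Lcomb)) (mean_D Lc Lcomb) (mean_comb _ _ LD LX).
  rewrite -(attains_tilted_mean At Hn) -KE'.
  have : mean (conj_at t1 t2) = v * t2 - k + t1 by rewrite -GE (GfunE t20 Hn); ring.
  by move=> ->; lra.
have mw0 : mean w = 0.
  apply/eqP; rewrite eq_le ae_ge0_mean//; last exact: L1_measurable Lw.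
  rewrite andbT mw; have [t1c'|ct1] := ltP t1 c; first by rewrite (mE t1c') subrr mulr0.
  by rewrite mulr_le0_ge0//; lra.
have wE : {ae mu, forall x, fconj f (s1 + s2 * X x) = (conj_at t1 t2 x +
    dens t1 t2 x * ((s1 - t1) + (s2 - t2) * X x))%:E}.
  apply: filterS2 (ae_mean0 Lw w0 mw0) sE => x wx xE; rewrite xE; congr EFin.
  by move: wx; rewrite /w; lra.
apply: filterS3 wE tc sc => x xE xc xsc.
rewrite [RHS]densE//; apply: fenchel_young_eq => //; first exact: dens_ge0.
by rewrite xE fext_dens// -EFinB lee_fin; lra.
Qed.

(** With full mass the equality case of Fenchel's inequality yields H = k and mean v,
    and weak duality shows that no admissible density has a smaller mean. *)
Lemma full_mass_worst_case (k v t1 t2 : R) : attains k v t2 -> normalised t1 t2 ->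
  mass t1 t2 = 1 ->
  density mu (dens t1 t2) /\ worst_case_density mu f X k (dens t1 t2).
Proof.
move=> At Hn m1; have [t20 GE H] := At; have [t1c tc LD _ _] := Hn.
have dD : density mu (dens t1 t2) by apply: L1_density => //; exact: dens_ge0.
have vE := attains_tilted_mean At Hn.
have XE : Xmean mu X (dens t1 t2) = v%:E.
  by rewrite /Xmean -EFin_mean ?vE//; exact: normalised_L1_XD.
have HE : (Hfun mu f (dens t1 t2) <= k%:E)%E.
  rewrite (Hfun_dens t20 Hn) lee_fin.
  by have [_] := mean_entropy t20 Hn; rewrite m1 -vE GE; lra.
do 2!split => //; rewrite XE; apply/eqP; rewrite eq_le; apply/andP; split; last first.
  by apply: ereal_inf_lbound; exists (dens t1 t2).
apply: le_ereal_inf_tmp => _ [p [dp Hp] <-].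
have [Xfin|] := ltP (Xmean mu X p) +oo%E; last exact: le_trans (leey _).
have [_ XpE] := Xmean_L1 dp Xfin.
have := weak_duality_G t20 dp XpE Hp; rewrite XpE lee_fin GE.
set b := mean (fun x => X x * p x) => le.
by rewrite -(ler_nM2l t20); lra.
Qed.

(** * The critical radius *)

Lemma normalised_attains (t1 t2 : R) : t2 < 0 -> normalised t1 t2 ->
  attains (t2 * tilted_mean t1 t2 - G t2) (tilted_mean t1 t2) t2.
Proof.
move=> t20 Hn; split => //; first by ring.
by move=> s s0; have := G_subgradient t20 s0 Hn; lra.
Qed.

Lemma G_right_quotient (t h : R) : 0 < h < - t ->
  ((h^-1)%:E * (Gfun mu f X (t + h) - Gfun mu f X t) = ((G (t + h) - G t) / h)%:E)%E.
Proof.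
move=> /andP[h0 ht].
have t0 : t < 0 by lra.
have th0 : t + h < 0 by lra.
by rewrite !GfunG// -EFinB -EFinM mulrC.
Qed.

(** Right difference quotients of a convex function decrease to their infimum, which
    is again a subgradient, hence the only one. *)
Lemma GrightE (t1 t2 : R) : t2 < 0 -> normalised t1 t2 ->
  Gright mu f X t2 = (tilted_mean t1 t2)%:E.
Proof.
move=> t20 Hn.
(* The quotients are extended reals for all h; near 0 they are real. *)
pose S (h : R) := ((h^-1)%:E * (Gfun mu f X (t2 + h) - Gfun mu f X t2))%E.
have nd : {in Interval (BRight 0) (BLeft (- t2)) &, nondecreasing_fun S}.
  move=> h h'; rewrite !in_itv/= => hI hI' hh'.
  rewrite /S !G_right_quotient// lee_fin.
  have /andP[h0 ht] := hI; have /andP[h0' ht'] := hI'.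
  have th0 : t2 + h < 0 by lra.
  have th0' : t2 + h' < 0 by lra.
  have [s1 Hs] := normalised_exists (ltW th0).
  have := G_subgradient th0 t20 Hs; have := G_subgradient th0 th0' Hs.
  set s := tilted_mean s1 (t2 + h) => le1 le2.
  rewrite ler_pdivrMr// mulrAC ler_pdivlMr//.
  have : 0 <= (h' - h) * (s * h - (G (t2 + h) - G t2)) by rewrite mulr_ge0//; lra.
  nra.
have t2N : (BRight 0 < BLeft (- t2))%O by rewrite bnd_simp oppr_gt0.
have cv := @nondecreasing_at_right_cvge R S 0 (BLeft (- t2)) t2N nd.
set L := ereal_inf _ in cv.
have -> : Gright mu f X t2 = L by apply: cvg_lim.
have SE (s : R) : t2 < s -> s < 0 -> S (s - t2) = ((G s - G t2) / (s - t2))%:E.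
  move=> ts s0; have sI : 0 < s - t2 < - t2 by rewrite subr_gt0 ts/=; lra.
  by rewrite /S (G_right_quotient sI) [t2 + _]addrC subrK.
have Lle (s : R) : t2 < s -> s < 0 -> (L <= ((G s - G t2) / (s - t2))%:E)%E.
  move=> ts s0; rewrite -SE//; apply: ereal_inf_lbound; exists (s - t2) => //=.
  by rewrite in_itv/= subr_gt0 ts/=; lra.
have Lge : ((tilted_mean t1 t2)%:E <= L)%E.
  apply: le_ereal_inf_tmp => _ [h /= + <-]; rewrite in_itv/= => hI.
  rewrite /S G_right_quotient// lee_fin.
  have /andP[h0 ht] := hI; rewrite ler_pdivlMr//.
  have th0 : t2 + h < 0 by lra.
  by have := G_subgradient t20 th0 Hn; rewrite [_ + h]addrC addrK; lra.
have Lfin : L = (fine L)%:E.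
  rewrite fineK// fin_real// (lt_le_trans _ Lge) ?ltNyr//=.
  by apply: le_lt_trans (Lle (t2 / 2) _ _) (ltry _); lra.
rewrite Lfin; congr EFin; apply: (subgradient_unique t20 Hn) => s s0.
rewrite Lfin lee_fin in Lge.
have [ts|st|->] := ltrgtP t2 s.
- have := Lle _ ts s0; rewrite Lfin lee_fin ler_pdivlMr ?subr_gt0//; lra.
- have := G_subgradient t20 s0 Hn.
  have : 0 <= (fine L - tilted_mean t1 t2) * (t2 - s) by rewrite mulr_ge0//; lra.
  lra.
- by rewrite subrr mulr0 addr0.
Qed.

Lemma gfun_normalised (t : R) : normalised c t -> gfun mu f X c t = (mass c t)%:E.
Proof.
case=> _ tc LD _ _; rewrite EFin_mean//; apply: ae_eq_integral => //.
- exact: measurable_dfconj_tau.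
- exact: measurable_int LD.
- by apply: filterS tc => x xc _ /=; rewrite densE// dfconjE.
Qed.

Lemma gfun_fin (t : R) : (gfun mu f X c t < +oo)%E ->
  [/\ {ae mu, forall x, c + t * X x < c}, L1 (dens c t) &
    (mass c t)%:E = gfun mu f X c t].
Proof. exact: dfconj_int_le. Qed.

Lemma gfun_le1 (t : R) : (gfun mu f X c t <= 1)%E -> normalised c t.
Proof.
move=> g1; have [tc LD E] := gfun_fin (le_lt_trans g1 (ltry _)).
by split => //; [rewrite -lee_fin E|rewrite ltxx].
Qed.

Lemma gfun_le (s t : R) : s <= t -> (gfun mu f X c s <= gfun mu f X c t)%E.
Proof.
move=> st; apply: ae_ge0_le_integral => //.
- by move=> x _; exact: dfconj_ge0.
- exact: measurable_dfconj_tau.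
- by move=> x _; exact: dfconj_ge0.
- exact: measurable_dfconj_tau.
- by apply: filterS X_ge0 => x x0 _; apply: dfconj_le; rewrite lerD2l ler_wpM2r.
Qed.

Lemma X_not_ge (e : R) : 0 < e -> ~ {ae mu, forall x, e <= X x}.
Proof.
move=> e0 [N [mN N0 sN]]; have := X_lt_gt0 e0.
rewrite ltNge => /negP; apply; rewrite -N0; apply: le_measure; rewrite ?inE//.
  exact: measurable_X_lt.
by move=> x /= xe; apply: sN => /=; apply/negP; rewrite -ltNge.
Qed.

(** Left continuity of g, by Fatou's lemma. *)
Lemma gfun_left_le1 (t : R) : (forall s, s < t -> (gfun mu f X c s <= 1)%E) ->
  (gfun mu f X c t <= 1)%E.
Proof.
move=> H; apply: (@fatou_le _ _ _ mu (fun n x => dfconj f c (c + (t + (-1) / n.+1%:R) * X x))).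
- by move=> n; exact: measurable_dfconj_tau.
- by move=> n x; exact: dfconj_ge0.
- exact: measurable_dfconj_tau.
- by move=> x; exact: dfconj_ge0.
- apply: filterS X_ge0 => x x0; apply: dfconj_left_cvg.
    by move=> n; rewrite lerD2l ler_wpM2r// gerDl mulN1r oppr_le0.
  apply: cvgD; first exact: cvg_cst.
  by apply: cvgM; [exact: cvg_harmonicZ|exact: cvg_cst].
- by move=> n; apply: H; rewrite gtrDl mulN1r oppr_lt0.
Qed.

Lemma gfun0_gt1 : ~ (gfun mu f X c 0 <= 1)%E.
Proof.
move=> /gfun_le1[_ tc _ _ _].
have : mean (fun=> 1) <= mean (fun=> 0) :> R.
  apply: ae_le_mean; [exact: L1_cst|exact: L1_cst|].
  by apply: filterS tc => x; rewrite mul0r addr0 ltxx.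
by rewrite !mean_cst ler10.
Qed.

Lemma worst_case_gfun_pinfty (k : R) : (forall t, t < 0 -> gfun mu f X c t = +oo%E) ->
  0 < k -> (k%:E < kmax mu f X 0)%E -> exists p, worst_case_density mu f X k p.
Proof.
move=> goo k0 kk; have [v [t At]] := attains_exists k0 (kmax_dual kk).
have [t0 _ _] := At; have [t1 Hn] := normalised_exists (ltW t0).
exists (dens t1 t); apply: (proj2 (full_mass_worst_case At Hn _)).
have [t1c _ _ _ mE] := Hn; apply: mE; rewrite lt_neqAle t1c andbT.
apply/eqP => t1E; rewrite t1E in Hn.
by have := gfun_normalised Hn; rewrite goo.
Qed.

Section critical_radius.
Context (t0 : R) (t0_lt0 : t0 < 0) (gfun_t0 : (gfun mu f X c t0 < +oo)%E).

(** On {X = 0} the integrand of g is +oo. *)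
Lemma X_gt0 : {ae mu, forall x, 0 < X x}.
Proof.
have [tc _ _] := gfun_fin gfun_t0; apply: filterS tc => x.
by rewrite gtrDl nmulr_rlt0.
Qed.

(** As t tends to -oo the argument c + t X tends to -oo almost everywhere and the
    integrand to 0, dominated by the integrand at t0. *)
Lemma gfun_lt1_exists : exists t, t < 0 /\ (gfun mu f X c t < 1)%E.
Proof.
have [tc LD _] := gfun_fin gfun_t0.
pose u (n : nat) : R := t0 - n%:R.
have ut n : u n <= t0 by rewrite gerBl.
apply: contrapT => nex.
have g1 n : (1 <= gfun mu f X c (u n))%E.
  rewrite leNgt; apply/negP => H; apply: nex; exists (u n); split => //.
  exact: le_lt_trans (ut n) t0_lt0.
have : (1 : R) <= mean (fun=> 0).
  apply: (@dominated_ge _ _ _ mu (fun n => dens c (u n)) _ (dens c t0)) => //.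
  - by move=> n; exact: measurable_dens.
  - apply: filterS2 X_gt0 tc => x x0 xc; apply/cvgrPdist_le => e e0.
    near=> n; rewrite sub0r normrN ger0_norm ?dens_ge0//.
    have xn : c + u n * X x < df e.
      have : (c + t0 * X x - df e + 1) / X x <= n%:R.
        by near: n; exact: nbhs_infty_ger.
      by rewrite ler_pdivrMr// /u; lra.
    have xnc := lt_trans xn (derive1_lt_slope e0).
    by rewrite densE// ltW// psi_ltE.
  - apply: filterS2 X_gt0 tc => x x0 xc n; rewrite ger0_norm ?dens_ge0//.
    by apply: dens_le => //; rewrite lerD2l ler_wpM2r// ltW.
  - move=> n; have [_ _ E] := gfun_fin (le_lt_trans (gfun_le (ut n)) gfun_t0).
    by rewrite -lee_fin E.
by rewrite mean_cst ler10.
Unshelve. all: by end_near. Qed.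

(** Were the infimum nonnegative, left continuity would give g(0) <= 1, but g(0) = +oo. *)
Lemma theta_minP : exists th : R, [/\ theta_min mu f X c = th%:E, th < 0,
  forall t, t < th -> (gfun mu f X c t < 1)%E &
  forall t, th < t -> t <= 0 -> (1 <= gfun mu f X c t)%E].
Proof.
have [tl [tl0 gtl]] := gfun_lt1_exists.
have lo : (tl%:E <= theta_min mu f X c)%E.
  apply: le_ereal_inf_tmp => _ [t [t00 gt1] <-]; rewrite lee_fin leNgt.
  apply/negP => tlt; have := le_lt_trans (gfun_le (ltW tlt)) gtl.
  by rewrite ltNge gt1.
have below (t : R) : (t%:E < theta_min mu f X c)%E -> t <= 0 -> (gfun mu f X c t < 1)%E.
  move=> tt t00; rewrite ltNge; apply/negP => gt1.
  have : (theta_min mu f X c <= t%:E)%E by apply: ereal_inf_lbound; exists t.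
  by rewrite leNgt tt.
have hi : (theta_min mu f X c < 0)%E.
  rewrite ltNge; apply/negP => H; apply: gfun0_gt1; apply: gfun_left_le1 => s s0.
  by apply/ltW/below; [apply: lt_le_trans H; rewrite lte_fin|exact: ltW].
have [th fin] : exists th : R, theta_min mu f X c = th%:E.
  exists (fine (theta_min mu f X c)).
  rewrite fineK// fin_real// (lt_le_trans _ lo) ?ltNyr//=.
  exact: lt_trans hi (ltry _).
have th0 : th < 0 by rewrite -lte_fin -fin.
exists th; split; [exact: fin|exact: th0| |].
- by move=> t tt; apply: below; [rewrite fin lte_fin|exact/ltW/(lt_trans tt)].
- move=> t tt t00.
  have : (theta_min mu f X c < t%:E)%E by rewrite fin lte_fin.
  move=> /ereal_inf_lt[_ [s [s0 gs] <-]]; rewrite lte_fin => st.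
  exact: le_trans gs (gfun_le (ltW st)).
Qed.

Lemma dens_near0 (t : R) (x : T) : t < 0 -> c + t * X x < c ->
  X x < (df 1 - c) / t -> 1 <= dens c t x.
Proof.
move=> t00 xc; rewrite ltr_ndivlMr// => lt.
by rewrite densE// psi_leE//; lra.
Qed.

(** The tilted density is at least 1 where X is small, and X is positive. *)
Lemma tilted_mean_gt0 (t : R) : t < 0 -> normalised c t -> 0 < tilted_mean c t.
Proof.
move=> t00 Hn; rewrite lt_neqAle tilted_mean_ge0 andbT eq_sym; apply/eqP => s0.
have [_ tc LD _ _] := Hn.
have e0 : 0 < (df 1 - c) / t.
  by rewrite ltr_ndivlMr// mul0r subr_lt0 derive1_lt_slope.
apply: (X_not_ge e0).
have XD0 : {ae mu, forall x, X x * dens c t x = 0}.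
  apply: ae_mean0 s0; first exact: normalised_L1_XD.
  by apply: filterS X_ge0 => x x0; rewrite mulr_ge0// dens_ge0.
apply: filterS3 XD0 X_gt0 tc => x + x0 xc.
move=> /eqP; rewrite mulf_eq0 gt_eqF//= => /eqP D0.
rewrite leNgt; apply/negP => /(dens_near0 t00 xc).
by rewrite D0 ler10.
Qed.

(** The radius is the integral of f(D) plus c (1 - mass).  Comparing f with its
    tangent at 1 bounds this below by (c - f'(1)) (1 - mass) >= 0, and equality would
    mean D = 1, that is, X constant and positive. *)
Lemma critical_radius_gt0 (t : R) : t < 0 -> normalised c t ->
  0 < t * tilted_mean c t - G t.
Proof.
move=> t00 Hn; have [_ tc LD m1 _] := Hn.
have [Lent <-] := mean_entropy t00 Hn.
have a1c : df 1 < c := derive1_lt_slope ltr01.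
set r := fun x => dens c t x * (c + t * X x) - conj_at c t x.
have LD1 : L1 (fun x => dens c t x - 1) by apply: L1_B => //; exact: L1_cst.
have Lw : L1 (fun x => r x - df 1 * (dens c t x - 1)) by apply: L1_B => //; exact: L1_Z.
have w0 : {ae mu, forall x, 0 <= r x - df 1 * (dens c t x - 1)}.
  apply: filterS tc => x xc; rewrite subr_ge0 -lee_fin /r -fext_dens//.
  exact: fext_ge_tangent.
have wE : mean (fun x => r x - df 1 * (dens c t x - 1)) = mean r - df 1 * (mass c t - 1).
  by rewrite (mean_B Lent (L1_Z (df 1) LD1)) (mean_Z (df 1) LD1) (mean_B LD (L1_cst mu 1)) mean_cst.
have wge : 0 <= mean (fun x => r x - df 1 * (dens c t x - 1)).
  by apply: ae_ge0_mean => //; exact: L1_measurable Lw.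
have p0 : 0 <= (c - df 1) * (1 - mass c t) by rewrite mulr_ge0//; lra.
rewrite ltNge; apply/negP => H.
have w00 : mean (fun x => r x - df 1 * (dens c t x - 1)) = 0.
  by apply/eqP; rewrite eq_le wge andbT wE; lra.
have e0 : 0 < (df 1 - c) / t by rewrite ltr_ndivlMr// mul0r subr_lt0.
apply: (X_not_ge e0).
apply: filterS2 (ae_mean0 Lw w0 w00) tc => x wx xc.
have : dens c t x = psi (df 1).
  apply: fenchel_young_eq => //; first exact: dens_ge0.
  rewrite fconj_derive1_1 fext_dens// -EFinB lee_fin.
  by move: wx; rewrite /r; lra.
rewrite densE// => E.
have -> : (df 1 - c) / t = X x; last by [].
have <- : c + t * X x = df 1 by apply: psi_inj => //; rewrite E psi_derive1_1.
by rewrite addrC addKr mulrC mulKf// lt_eqF.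
Qed.

(** The bound k_max >= t b' - G(t) for a mean b' below that of the tilted density. *)
Lemma critical_radius_lt (t : R) : t < 0 -> normalised c t ->
  ((t * tilted_mean c t - G t)%:E < kmax mu f X 0)%E.
Proof.
move=> t00 Hn; have s0 := tilted_mean_gt0 t00 Hn; have sM := tilted_mean_le t00 Hn.
apply: lt_le_trans (kmax_ge t00 (b := tilted_mean c t / 2) _); last by apply/andP; split; lra.
by rewrite lte_fin ltrD2r ltr_nM2l//; lra.
Qed.

(** If g is finite and at least one at some t, then it is right continuous at th,
    where it is a limit of values that are at least one. *)
Lemma critical_full (th : R) : th < 0 -> normalised c th ->
  (forall t, t < th -> (gfun mu f X c t < 1)%E) ->
  (forall t, th < t -> t <= 0 -> (1 <= gfun mu f X c t)%E) ->
  ~ (forall t : R, t < 0 -> (gfun mu f X c t < +oo)%E -> (gfun mu f X c t < 1)%E) ->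
  mass c th = 1.
Proof.
move=> th0 Hn glt gge /existsNP[t /not_implyP[tn /not_implyP[gfin /negP]]].
rewrite -leNgt => g1; have [_ tc LD m1 _] := Hn.
apply/eqP; rewrite eq_le m1/=.
have [tth|tht|E] := ltrgtP t th; last 2 first.
- have q0 n : 0 < (t - th) / n.+1%:R by rewrite divr_gt0// subr_gt0.
  have qt n : th + (t - th) / n.+1%:R <= t.
    have tt0 : 0 <= t - th by rewrite subr_ge0 ltW.
    by rewrite -lerBrDl; have /andP[] := divn_le n tt0.
  have [ttc LDt _] := gfun_fin gfin.
  apply: (@dominated_ge _ _ _ mu (fun n => dens c (th + (t - th) / n.+1%:R)) _ (dens c t)) => //.
  + by move=> n; exact: measurable_dens.
  + exact: measurable_dens.
  + apply: filterS tc => x xc.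
    apply: (@dens_cvg (fun=> c) (fun n => th + (t - th) / n.+1%:R)) => //.
      exact: cvg_cst.
    exact: cvg_harmonicZ.
  + apply: filterS2 X_gt0 ttc => x x0 xc n; rewrite ger0_norm ?dens_ge0//.
    by apply: dens_le => //; rewrite lerD2l ler_wpM2r// ltW.
  + move=> n; have [_ _ E] := gfun_fin (le_lt_trans (gfun_le (qt n)) gfin).
    rewrite -lee_fin E; apply: gge; first by rewrite ltrDl.
    exact: le_trans (qt n) (ltW tn).
- by rewrite -lee_fin -(gfun_normalised Hn) -E.
- by have := glt _ tth; rewrite ltNge g1.
Qed.

(** As X > 0, any maximiser with s1 <= c keeps its argument below c almost everywhere. *)
Lemma localiser (k v t : R) : attains k v t -> normalised c t ->
  Theta mu f X c c t /\ worst_case_localiser mu f X c k (dens c t).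
Proof.
move=> At Hn; have [t00 _ _] := At; have [_ tc _ _ _] := Hn.
split; first by split => //; rewrite (normalised_Kfun t00 Hn) ltry.
split; first by exists c, t; exact: attains_maximiser At Hn.
move=> s1 s2 smax; have [s20 _] := smax.
have [Kfin Eq] := localiser_unique At Hn smax.
have s1c : s1 <= c.
  by rewrite leNgt; apply/negP => cs; move: Kfin; rewrite Kfun_pinfty// ltW.
have sc : {ae mu, forall x, s1 + s2 * X x < c}.
  apply: filterS X_gt0 => x x0.
  by have : s2 * X x < 0 by [rewrite nmulr_rlt0]; lra.
by split; [split|exact: Eq].
Qed.

(** The multiplier theta_min is itself a maximiser, for the radius k_cr; the position
    of all other maximisers follows from the monotonicity of [attains_lt]. *)
Lemma critical_radius_dichotomy :
   [/\ (-oo < theta_min mu f X c < 0)%E,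
       (0 < kcr mu f X c < kmax mu f X 0)%E,
       (forall k : R, (0 < k%:E < kcr mu f X c)%E ->
          exists p : T -> R, worst_case_density mu f X k p) &
       (forall k : R, (kcr mu f X c <= k%:E < kmax mu f X 0)%E ->
          exists th2 : R,
            let q := ptheta f X c c th2 in
            [/\ th2 < 0, Theta mu f X c c th2,
                worst_case_localiser mu f X c k q,
                (kcr mu f X c < k%:E)%E -> ~ density mu q &
                k%:E = kcr mu f X c ->
                ~ (forall t : R, t < 0 -> (gfun mu f X c t < +oo)%E ->
                     (gfun mu f X c t < 1)%E) ->
                density mu q /\ worst_case_density mu f X k q])].
Proof.
have [th [thE th0 glt gge]] := theta_minP.
have Hn : normalised c th by apply/gfun_le1/gfun_left_le1 => s /glt/ltW.
have [kc kcE] : exists kc : R, kc = th * tilted_mean c th - G th by eexists.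
have kcrE : kcr mu f X c = kc%:E.
  by rewrite /kcr thE/= (GrightE th0 Hn) GfunG// -EFinM -EFinB kcE.
have Ath : attains kc (tilted_mean c th) th by rewrite kcE; exact: normalised_attains.
have kcmax : (kc%:E < kmax mu f X 0)%E by rewrite kcE critical_radius_lt.
have kc0 : 0 < kc by rewrite kcE critical_radius_gt0.
rewrite thE kcrE; split.
- by rewrite ltNyr lte_fin.
- by rewrite kcmax lte_fin kc0.
- move=> k; rewrite !lte_fin => /andP[k0 kkc].
  have kk : (k%:E < kmax mu f X 0)%E by apply: lt_trans kcmax; rewrite lte_fin.
  have [v [t At]] := attains_exists k0 (kmax_dual kk).
  have tht := attains_lt At Ath kkc; have [t00 _ _] := At.
  have [t1 Hn1] := normalised_exists (ltW t00).
  exists (dens t1 t); apply: (proj2 (full_mass_worst_case At Hn1 _)).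
  have [t1c _ _ m1 mE] := Hn1; have [/mE//|ct1] := ltP t1 c.
  have t1E : t1 = c by apply/eqP; rewrite eq_le t1c.
  rewrite t1E in Hn1 m1 *; apply/eqP; rewrite eq_le m1/= -lee_fin -gfun_normalised//.
  by apply: gge => //; exact: ltW.
- move=> k; rewrite lee_fin le_eqVlt => /andP[/predU1P[<- _|kck kk]].
    exists th; have [Th Loc] := localiser Ath Hn.
    split => //; first by rewrite ltxx.
    by move=> _ H; exact: full_mass_worst_case Ath Hn (critical_full th0 Hn glt gge H).
  have [v [t At]] := attains_exists (lt_trans kc0 kck) (kmax_dual kk).
  have tth := attains_lt Ath At kck; have [t00 _ _] := At.
  have gt1 := glt _ tth; have Hnt := gfun_le1 (ltW gt1).
  have [Th Loc] := localiser At Hnt.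
  exists t; split; [exact: t00|exact: Th|exact: Loc| |].
    move=> _ /density_L1[_ mE]; move: gt1.
    by rewrite (gfun_normalised Hnt) mE ltxx.
  by move=> [E]; move: kck; rewrite E ltxx.
Qed.

End critical_radius.

End worst_case_model.

(** * The theorem *)

Local Open Scope ereal_scope.

Theorem theorem4 (d : measure_display) (T : measurableType d) (R : realType)
    (mu : probability T R) (f : R -> R) (c : R) (X : T -> R)
    (f_convex : strictly_convex_pos f)
    (f_diff : forall s : R, (0 < s)%R -> derivable f s 1%R)
    (f1 : f 1%R = 0%R)
    (f_slope : (f s / s)%R @[s --> +oo%R] --> c)
    (mX : measurable_fun [set: T] X)
    (X_inf : ess_inf mu (EFin \o X) = 0)
    (b0_gt0 : 0 < \int[mu]_x (X x)%:E)
    (b0_ltM : \int[mu]_x (X x)%:E < ess_sup mu (EFin \o X))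
    (kmax_gt0 : 0 < kmax mu f X 0%R) :
  ((forall th2 : R, (th2 < 0)%R -> gfun mu f X c th2 = +oo) ->
   forall k : R, 0 < k%:E < kmax mu f X 0%R ->
     exists p : T -> R, worst_case_density mu f X k p)
  /\
  (~ (forall th2 : R, (th2 < 0)%R -> gfun mu f X c th2 = +oo) ->
   [/\ -oo < theta_min mu f X c < 0,
       0 < kcr mu f X c < kmax mu f X 0%R,
       (forall k : R, 0 < k%:E < kcr mu f X c ->
          exists p : T -> R, worst_case_density mu f X k p) &
       (forall k : R, kcr mu f X c <= k%:E < kmax mu f X 0%R ->
          exists th2 : R,
            let q := ptheta f X c c th2 in
            [/\ (th2 < 0)%R, Theta mu f X c c th2,
                worst_case_localiser mu f X c k q,
                kcr mu f X c < k%:E -> ~ density mu q &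
                k%:E = kcr mu f X c ->
                ~ (forall t : R, (t < 0)%R -> gfun mu f X c t < +oo ->
                     gfun mu f X c t < 1) ->
                density mu q /\ worst_case_density mu f X k q])]).
Proof.
have GE (t : R) : (t < 0)%R -> Gfun mu f X t = (fine (Gfun mu f X t))%:E.
  by apply: (@Gfun_fin R f c) => //.
split=> [goo k /andP[k0 kk]|].
  by apply: (worst_case_gfun_pinfty f_convex f_diff f1 f_slope mX X_inf b0_gt0 b0_ltM GE goo) kk.
move=> /existsNP[t /not_implyP[t0 gt]].
apply: (critical_radius_dichotomy f_convex f_diff f1 f_slope mX X_inf b0_gt0 b0_ltM GE t0).
by rewrite lt_neqAle leey andbT; apply/eqP.
Qed.
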